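(* Let $(T_1,T_2)$ be any commuting contractive pair on $\mathcal H$. Then any special And\^o tuple for $(T_1^*,T_2^* )$ is also a Type I And\^o tuple for $(T_1^*,T_2^* )$. In particular, the class of Type I And\^o tuples for $(T_1^*,T_2^* )$ is not empty, and And\^o lifts of $(T_1,T_2)$ exist.
   Context: Commuting contractive pair: commuting operators of norm at most $1$; $T=T_1T_2$; Hilbert spaces are separable. For a contraction $A$: $D_{A^*}=(I-AA^* )^{1/2}$, $\mathcal D_{A^*}=\overline{\operatorname{Ran}}\,D_{A^*}$. $P^\perp=I-P$. A pre-And\^o tuple for $(T_1^*,T_2^* )$ is $(\mathcal F,\Lambda,P,U)$ with $\mathcal F$ a Hilbert space, $\Lambda:\mathcal D_{T^*}\to\mathcal F$ an isometry, $P$ an orthogonal projection and $U$ a unitary on $\mathcal F$. Two pre-And\^o tuples coincide if there is a unitary $\tau:\mathcal F\to\mathcal F'$ with $\tau\Lambda=\Lambda'$, $\tau P\tau^*=P'$, $\tau U\tau^*=U'$. A pre-And\^o tuple is a Type I And\^o tuple for $(T_1^*,T_2^* )$ if $$P^\perp U\Lambda D_{T^*}+PU\Lambda D_{T^*}T^*=\Lambda D_{T^*}T_1^*,\qquad U^*P\Lambda D_{T^*}+U^*P^\perp\Lambda D_{T^*}T^*=\Lambda D_{T^*}T_2^*.$$ A canonical special And\^o tuple for $(T_1^*,T_2^* )$ is $(\mathcal F_\dagger,\Lambda_\dagger,P_\dagger,U_\dagger)$ where $\mathcal F_\dagger=\mathcal D_{T_1^*}\oplus\mathcal D_{T_2^*}\oplus\mathcal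 F_{\dagger0}$ for some Hilbert space $\mathcal F_{\dagger0}$ (possibly $\{0\}$); $\Lambda_\dagger:\mathcal D_{T^*}\to\mathcal F_\dagger$ is the isometry determined by $D_{T^*}h\mapsto D_{T_1^*}T_2^*h\oplus D_{T_2^*}h\oplus0$; $U_\dagger$ is any unitary on $\mathcal F_\dagger$ with $U_\dagger(D_{T_1^*}T_2^*h\oplus D_{T_2^*}h\oplus0)=D_{T_1^*}h\oplus D_{T_2^*}T_1^*h\oplus0$ for all $h\in\mathcal H$; and $P_\dagger(d\oplus r\oplus f)=d\oplus0\oplus P_{\dagger0}f$ for some orthogonal projection $P_{\dagger0}$ on $\mathcal F_{\dagger0}$. A special And\^o tuple is a pre-And\^o tuple coinciding with a canonical special And\^o tuple. And\^o lift of $(T_1,T_2)$: $(\Pi,V_1,V_2)$ with $\Pi:\mathcal H\to\mathcal K$ isometric and commuting isometries $V_1,V_2$ on $\mathcal K$ with $V_j^*\Pi=\Pi T_j^*$. *)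

(* Defs.v *)
From HB Require Import structures.
From mathcomp Require Import all_boot all_order all_algebra.
From mathcomp Require Import complex.
From mathcomp Require Import all_classical all_reals interval_inference.
From mathcomp Require Import topology normedtype.

(* The scalars are the complex numbers R[i] over a realType R. *)

Set Implicit Arguments.
Unset Strict Implicit.
Unset Printing Implicit Defensive.

Import Order.TTheory GRing.Theory Num.Theory.
Import numFieldNormedType.Exports.

Local Open Scope classical_set_scope.
Local Open Scope complex_scope.
Local Open Scope ring_scope.

(* The inner product is linear in its first argument and conjugate-linear in
   its second one; norms take their values in the nonnegative reals of R[i]. *)
HB.mixin Record NormedModule_isPreHilbert (R : realType) V
    & NormedModule R[i] V := {
  inner : {dot V for @Num.conj R[i]} ;
  sqr_norm_inner : forall x : V, `|x| ^+ 2 = inner x x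
}.

#[short(type="preHilbertType")]
HB.structure Definition PreHilbert (R : realType) :=
  {V of NormedModule R[i] V & NormedModule_isPreHilbert R V}.

#[short(type="hilbertType")]
HB.structure Definition Hilbert (R : realType) :=
  {V of PreHilbert R V & CompleteNormedModule R[i] V}.

HB.mixin Record isSeparable (V : Type) & Topological V := {
  separable_ex : exists2 S : set V, countable S & dense S
}.

#[short(type="separableHilbertType")]
HB.structure Definition SeparableHilbert (R : realType) :=
  {V of Hilbert R V & isSeparable V}.

HB.factory Record Lmodule_isPreHilbert (R : realType) V & GRing.Lmodule R[i] V := {
  dot : {dot V for @Num.conj R[i]}
}.
HB.builders Context R V & Lmodule_isPreHilbert R V.
Let C : numClosedFieldType := R[i].
Let nrm (x : V) : C := sqrtC (dot x x).

Let nrm_ge0 x : 0 <= nrm x. Proof. by rewrite sqrtC_ge0 dnorm_ge0. Qed.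

Let CS (u v : V) : `|dot u v| <= nrm u * nrm v.
Proof.
have [->|v0] := eqVneq v 0.
  by rewrite linear0r normr0 mulr_ge0.
have vv0 : 0 < dot v v by rewrite dnorm_gt0.
pose a := dot u v / dot v v.
have ou : dot (u - a *: v) (a *: v) = 0.
  by rewrite linearZr_LR linearBl linearZl_LR/= divfK ?subrr ?mulr0 ?gt_eqF.
have uu : dot u u = dot (u - a *: v) (u - a *: v) + `|a| ^+ 2 * dot v v.
  by rewrite -dnormZ -[X in dot X X = _](subrK (a *: v) u); exact: hnormDd.
have : `|a| ^+ 2 * dot v v <= dot u u by rewrite uu lerDr dnorm_ge0.
rewrite -(ler_pM2r vv0) -mulrA -expr2 -exprMn normf_div (ger0_norm (ltW vv0)).
rewrite divfK ?gt_eqF// => h.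
by rewrite -(ler_pXn2r (_ : 0 < 2)%N)// ?nnegrE ?mulr_ge0// exprMn !sqrtCK.
Qed.

Let nrmD x y : nrm (x + y) <= nrm x + nrm y.
Proof.
rewrite -(ler_pXn2r (_ : 0 < 2)%N)// ?nnegrE ?addr_ge0// sqrrD !sqrtCK dnormD.
rewrite addrAC lerD2r lerD2l.
have := leif_Re_Creal (dot x y); rewrite ReE => -[h _].
have := le_trans h (CS x y); rewrite ler_pdivrMr// => h2.
by rewrite (le_trans h2)// mulr_natr.
Qed.

Let nrmZ (l : C) x : nrm (l *: x) = `|l| * nrm x.
Proof. by rewrite /nrm dnormZ sqrtCM ?nnegrE ?exprn_ge0 ?dnorm_ge0// sqrCK. Qed.

Let nrm0 x : nrm x = 0 -> x = 0.
Proof. by move/eqP; rewrite sqrtC_eq0 dnorm_eq0 => /eqP. Qed.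

HB.instance Definition _ := Lmodule_isNormed.Build R[i] V nrmD nrmZ nrm0.

Let sqrn (x : V) : `|x| ^+ 2 = dot x x.
Proof. by rewrite /Num.norm/= sqrtCK. Qed.

HB.instance Definition _ := NormedModule_isPreHilbert.Build R V sqrn.
HB.end.

Notation "''[' u , v ]" := (inner u v) : ring_scope.

Lemma invS_lt_complex (R : realType) (e : R[i]) :
  0 < e -> exists n : nat, n.+1%:R^-1 < e.
Proof.
move=> e0; have er : e = (complex.Re e)%:C by rewrite RRe_real ?gtr0_real.
have re0 : 0 < complex.Re e by rewrite -ltcR -er.
have [n _ /(_ n (leqnn n)) h] := near_infty_natSinv_lt (PosNum re0).
exists n; rewrite er (_ : n.+1%:R^-1 = (n.+1%:R^-1 : R)%:C) ?ltcR//.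
by rewrite fmorphV rmorph_nat.
Qed.

Lemma dense_normP (K : numFieldType) (V : normedModType K) (S : set V) :
  dense S <-> forall (x : V) (e : K), 0 < e -> exists2 s, S s & `|x - s| < e.
Proof.
split=> [dS x e e0|h O [x Ox] oO].
  have [] := dS (ball x e)°; last 2 first.
  - exact: open_interior.
  - by move=> s [/interior_subset + Ss]; rewrite -ball_normE => ?; exists s.
  by exists x; apply: nbhsx_ballx.
have /nbhs_ballP[e /= e0 xeO] : nbhs x O by exact: open_nbhs_nbhs.
have [s Ss xs] := h x e e0; exists s; split => //; apply: xeO.
by rewrite -ball_normE.
Qed.

Lemma closure_normP (K : numFieldType) (V : normedModType K) (A : set V)
    (x : V) :
  closure A x <-> forall e : K, 0 < e -> exists2 a, A a & `|x - a| < e.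
Proof.
split=> [Ax e e0|h B /nbhs_ballP[e /= e0 xeB]].
  have [a [Aa]] := Ax _ (nbhsx_ballx x e e0).
  by rewrite -ball_normE => ?; exists a.
have [a Aa xa] := h e e0; exists a; split => //; apply: xeB.
by rewrite -ball_normE.
Qed.

Record closed_subspace (R : realType) (H : hilbertType R) := ClosedSubspace {
  csub_set :> set H ;
  csub_closed : closed csub_set ;
  csub_submod : submod_closed (mem csub_set)
}.

Record subsp_type (R : realType) (H : hilbertType R)
    (W : closed_subspace H) := SubspElem {
  subsp_val : H ;
  subsp_valP : subsp_val \in csub_set W
}.

Section subspace.
Variables (R : realType) (H : hilbertType R) (W : closed_subspace H).
Local Notation T := (subsp_type W).

HB.instance Definition _ := [isSub of T for @subsp_val R H W].
HB.instance Definition _ := [Choice of T by <:].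
HB.instance Definition _ :=
  GRing.SubChoice_isSubLmodule.Build R[i] H (mem (csub_set W)) T (csub_submod W).

Definition subsp_inner (u v : T) : R[i] := '[val u, val v].

Let inner_Bl u' : zmod_morphism (subsp_inner ^~ u').
Proof. by move=> x y; rewrite /subsp_inner raddfB linearBl. Qed.
Let inner_Br u : zmod_morphism (subsp_inner u).
Proof. by move=> x y; rewrite /subsp_inner [val (x - y)]raddfB linearBr. Qed.
Let inner_Zl u' : scalable_for *%R (subsp_inner ^~ u').
Proof. by move=> a x; rewrite /subsp_inner linearZ linearZl_LR. Qed.
Let inner_Zr u : scalable_for (@Num.conj R[i] \; *%R) (subsp_inner u).
Proof. by move=> a x; rewrite /subsp_inner [val (a *: x)]linearZ linearZr_LR. Qed.
HB.instance Definition _ := isBilinear.Build R[i] T T R[i] *%R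
  (@Num.conj R[i] \; *%R) subsp_inner inner_Bl inner_Br inner_Zl inner_Zr.

Let inner_herm u v : subsp_inner u v = (-1) ^+ false * (subsp_inner v u)^*.
Proof. by rewrite /subsp_inner hermC. Qed.
HB.instance Definition _ := isHermitianSesquilinear.Build R[i] T false
  (@Num.conj R[i]) subsp_inner inner_herm.

Let inner_gt0 u : u != 0 -> 0 < subsp_inner u u.
Proof.
move=> u0; rewrite dnorm_gt0; apply: contra u0 => /eqP u0.
by apply/eqP/val_inj; rewrite raddf0.
Qed.
HB.instance Definition _ := isDotProduct.Build R[i] T subsp_inner inner_gt0.

HB.instance Definition _ := Lmodule_isPreHilbert.Build R T subsp_inner.

Lemma subsp_innerE (u v : T) : '[u, v] = '[val u, val v].
Proof. by []. Qed.

Lemma subsp_norm (u : T) : `|u| = `|val u|.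
Proof.
by apply: (pexpIrn (_ : 0 < 2)%N); rewrite ?nnegrE// !sqr_norm_inner.
Qed.

Lemma subsp_ball (x y : T) (e : R[i]) : ball x e y = ball (val x) e (val y).
Proof. by rewrite -2!ball_normE /ball_ /mkset subsp_norm raddfB. Qed.

Let subsp_complete (F : set_system T) : ProperFilter F -> cauchy F -> cvg F.
Proof.
move=> FF /cauchyP Fc.
have : cauchy (fmap val F).
  apply/cauchy_exP => e e0; have [x Fx] := Fc e e0; exists (val x).
  by apply: (@filterS _ F _ (ball x e)) => // y; rewrite subsp_ball.
move=> /cauchy_cvg/cvg_ex[l Fl].
have Wl : l \in csub_set W.
  have Wval : \forall x \near F, csub_set W (val x).
    by apply: nearW => x; have := valP x; rewrite inE.
  rewrite inE.
  exact: (@closed_cvg _ _ F FF (val : T -> H) _ (@csub_closed _ _ W) Wval).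
apply/cvg_ex; exists (SubspElem Wl); apply/fcvg_ballP => e e0.
have Fb : F [set y : T | ball l e (val y)] by exact: (cvg_ball Fl e0).
by apply: (@filterS _ F _ [set y : T | ball l e (val y)]) Fb => y;
  rewrite subsp_ball.
Qed.
HB.instance Definition _ := Uniform_isComplete.Build T subsp_complete.

End subspace.

Section subspace_separable.
Variables (R : realType) (H : separableHilbertType R) (W : closed_subspace H).
Local Notation T := (subsp_type W).

Let subsp_sep : exists2 S : set T, countable S & dense S.
Proof.
have [S Sc /dense_normP Sd] := @separable_ex R H.
pose p (ns : nat * H) : T :=
  xget 0 [set w : T | `|val w - ns.2| < ns.1.+1%:R^-1].
exists (p @` ([set: nat] `*` S)).
  apply: sub_countable (card_image_le _ _) _.
  exact: countableX.
apply/dense_normP => x e e0.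
have [n ne] := invS_lt_complex (divr_gt0 e0 (ltr0Sn R[i] 1)).
have n0 : 0 < n.+1%:R^-1 :> R[i] by rewrite invr_gt0 ltr0Sn.
have [s Ss xs] := Sd (val x) _ n0.
exists (p (n, s)); first by exists (n, s).
have : `|val (p (n, s)) - s| < n.+1%:R^-1.
  rewrite /p; case: xgetP => [y _ /= //|/(_ x)/=] /(_ xs) [].
rewrite subsp_norm raddfB => ps.
rewrite (splitr e) (le_lt_trans (ler_distD s _ _))// ltrD//.
  exact: lt_trans xs ne.
by rewrite distrC (lt_trans ps ne).
Qed.
HB.instance Definition _ := isSeparable.Build T subsp_sep.

End subspace_separable.


(* Hilbert space direct sum. The alias keeps the l^2 norm apart from the max
   norm that the library puts on A * B. *)
Definition hsum (A B : Type) : Type := (A * B)%type.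

Section direct_sum.
Variables (R : realType) (A B : hilbertType R).
Local Notation T := (hsum A B).

HB.instance Definition _ := GRing.Lmodule.copy T (A * B)%type.

Definition hsum_inner (u v : T) : R[i] := '[u.1, v.1] + '[u.2, v.2].

Let inner_Bl u' : zmod_morphism (hsum_inner ^~ u').
Proof.
by move=> x y; rewrite /hsum_inner /= !linearBl opprD addrACA.
Qed.
Let inner_Br u : zmod_morphism (hsum_inner u).
Proof.
by move=> x y; rewrite /hsum_inner /= !linearBr opprD addrACA.
Qed.
Let inner_Zl u' : scalable_for *%R (hsum_inner ^~ u').
Proof. by move=> a x; rewrite /hsum_inner /= !linearZl_LR mulrDr. Qed.
Let inner_Zr u : scalable_for (@Num.conj R[i] \; *%R) (hsum_inner u).
Proof. by move=> a x; rewrite /hsum_inner /= !linearZr_LR mulrDr. Qed.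
HB.instance Definition _ := isBilinear.Build R[i] T T R[i] *%R
  (@Num.conj R[i] \; *%R) hsum_inner inner_Bl inner_Br inner_Zl inner_Zr.

Let inner_herm u v : hsum_inner u v = (-1) ^+ false * (hsum_inner v u)^*.
Proof.
by rewrite /hsum_inner expr0 mul1r rmorphD hermC [X in _ + X]hermC !expr0 !mul1r.
Qed.
HB.instance Definition _ := isHermitianSesquilinear.Build R[i] T false
  (@Num.conj R[i]) hsum_inner inner_herm.

Let inner_gt0 u : u != 0 -> 0 < hsum_inner u u.
Proof.
case: u => a b; rewrite /hsum_inner/= lt_def addr_ge0 ?dnorm_ge0// andbT.
by apply: contra; rewrite paddr_eq0 ?dnorm_ge0// !dnorm_eq0 => /andP[/eqP-> /eqP->].
Qed.
HB.instance Definition _ := isDotProduct.Build R[i] T hsum_inner inner_gt0.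

HB.instance Definition _ := Lmodule_isPreHilbert.Build R T hsum_inner.

Lemma hsum_innerE (u v : T) : '[u, v] = '[u.1, v.1] + '[u.2, v.2].
Proof. by []. Qed.

Lemma sqr_hsum_norm (u : T) : `|u| ^+ 2 = `|u.1| ^+ 2 + `|u.2| ^+ 2.
Proof. by rewrite !sqr_norm_inner. Qed.

Lemma hsum_norm1 (u : T) : `|u.1| <= `|u|.
Proof.
by rewrite -(ler_pXn2r (_ : 0 < 2)%N) ?nnegrE// sqr_hsum_norm lerDl exprn_ge0.
Qed.

Lemma hsum_norm2 (u : T) : `|u.2| <= `|u|.
Proof.
by rewrite -(ler_pXn2r (_ : 0 < 2)%N) ?nnegrE// sqr_hsum_norm lerDr exprn_ge0.
Qed.

Lemma hsum_norm_le (u : T) : `|u| <= `|u.1| + `|u.2|.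
Proof.
rewrite -(ler_pXn2r (_ : 0 < 2)%N) ?nnegrE ?addr_ge0// sqr_hsum_norm sqrrD.
by rewrite addrAC lerDl mulrn_wge0 ?mulr_ge0.
Qed.

Let hsum_complete (F : set_system T) : ProperFilter F -> cauchy F -> cvg F.
Proof.
move=> FF /cauchyP Fc.
have c1 : cauchy (fmap (fst : T -> A) F).
  apply/cauchy_exP => e e0; have [x Fx] := Fc e e0; exists x.1.
  apply: (@filterS _ F _ (ball x e)) => // y; rewrite -ball_normE /ball_ /mkset => h.
  change (ball x.1 e y.1); rewrite -ball_normE /ball_ /mkset.
  exact: le_lt_trans (hsum_norm1 (x - y)) h.
have c2 : cauchy (fmap (snd : T -> B) F).
  apply/cauchy_exP => e e0; have [x Fx] := Fc e e0; exists x.2.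
  apply: (@filterS _ F _ (ball x e)) => // y; rewrite -ball_normE /ball_ /mkset => h.
  change (ball x.2 e y.2); rewrite -ball_normE /ball_ /mkset.
  exact: le_lt_trans (hsum_norm2 (x - y)) h.
move: c1 c2 => /cauchy_cvg/cvg_ex[a Fa] /cauchy_cvg/cvg_ex[b Fb].
apply/cvg_ex; exists ((a, b) : T); apply/fcvg_ballP => e e0.
have e20 : 0 < e / 2 by rewrite divr_gt0.
have F1 : F [set y : T | ball a (e / 2) y.1] by exact: (cvg_ball Fa e20).
have F2 : F [set y : T | ball b (e / 2) y.2] by exact: (cvg_ball Fb e20).
apply: (@filterS _ F _ _ _ _ (filterI F1 F2)) => y [].
rewrite /mkset -!ball_normE /ball_ /mkset => h1 h2.
by rewrite (le_lt_trans (hsum_norm_le _))// (splitr e) ltrD.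
Qed.
HB.instance Definition _ := Uniform_isComplete.Build T hsum_complete.
End direct_sum.

Section direct_sum_separable.
Variables (R : realType) (A B : separableHilbertType R).
Local Notation T := (hsum A B).

Let hsum_sep : exists2 S : set T, countable S & dense S.
Proof.
have [S Sc /dense_normP Sd] := @separable_ex R A.
have [S' Sc' /dense_normP Sd'] := @separable_ex R B.
exists (S `*` S' : set T); first exact: countableX.
apply/dense_normP => x e e0; have e20 : 0 < e / 2 by rewrite divr_gt0.
have [s Ss xs] := Sd x.1 _ e20; have [s' Ss' xs'] := Sd' x.2 _ e20.
exists ((s, s') : T); first by [].
by rewrite (le_lt_trans (hsum_norm_le _))// (splitr e) ltrD.
Qed.
HB.instance Definition _ := isSeparable.Build T hsum_sep.
End direct_sum_separable.

Section operators.
Variable R : realType.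
Implicit Types H K : hilbertType R.

Lemma closure_range_submod H K (A : {linear H -> K}) :
  submod_closed (mem (closure (range A))).
Proof.
split=> [|a x y]; rewrite !inE.
  by apply: subset_closure; exists 0; rewrite ?linear0.
move=> /closure_normP Ax /closure_normP Ay; apply/closure_normP => e e0.
have a0 : 0 < `|a| + 1 by rewrite ltr_wpDl.
have [_ [u _ <-] xu] := Ax _ (divr_gt0 (divr_gt0 e0 (ltr0Sn _ 1)) a0).
have [_ [v _ <-] yv] := Ay _ (divr_gt0 e0 (ltr0Sn _ 1)).
exists (A (a *: u + v)); first by exists (a *: u + v).
rewrite linearP opprD addrACA -scalerBr (le_lt_trans (ler_normD _ _))//.
rewrite (splitr e) ltr_leD// ?(ltW yv)// normrZ.
rewrite (le_lt_trans (_ : _ <= (`|a| + 1) * `|x - A u|))//.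
  by rewrite ler_wpM2r// lerDl.
by rewrite mulrC -ltr_pdivlMr.
Qed.

Definition range_closure H K (A : {linear H -> K}) : closed_subspace K :=
  ClosedSubspace (@closed_closure _ (range A)) (closure_range_submod A).

Definition select (T : Type) (x0 : T) (P : T -> Prop) : T :=
  if pselect (exists x, P x) is left exP then sval (cid exP) else x0.

(* The adjoint A^*: for bounded A, the Riesz theorem shows that the predicate
   determines a unique operator, so that the default value \0 is not used. *)
Definition adj H K (A : {linear H -> K}) : {linear K -> H} :=
  @select {linear K -> H} \0
    (fun B : {linear K -> H} => forall x y, '[A x, y] = '[x, B y]).

(* A^(1/2) for a bounded positive operator A: the unique bounded positive S
   with S^2 = A. The order of R[i] makes 0 <= '[S x, x] say that this number is
   real and nonnegative. *)
Definition possqrt H (A : H -> H) : {linear H -> H} :=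
  @select {linear H -> H} \0 (fun S : {linear H -> H} =>
    [/\ continuous S, forall x, 0 <= '[S x, x] & forall x, S (S x) = A x]).

(* Operator norm at most 1. *)
Definition contractive H K (A : {linear H -> K}) := forall x, `|A x| <= `|x|.

Definition isometric H K (A : {linear H -> K}) := forall x, `|A x| = `|x|.

Definition unitary H K (U : {linear H -> K}) :=
  isometric U /\ forall y, exists x, U x = y.

Definition orthoproj H (P : {linear H -> H}) :=
  (forall x, P (P x) = P x) /\ (forall x y, '[P x, y] = '[x, P y]).

(* P^perp = I - P *)
Definition perp H (P : {linear H -> H}) (x : H) : H := x - P x.

(* D_{A^*} = (I - A A^* )^(1/2) *)
Definition defect_adj H (A : {linear H -> H}) : {linear H -> H} :=
  possqrt (fun x => x - A (adj A x)).

(* The defect space of A^*, i.e. the closure of the range of D_{A^*}. *)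
Definition defect_space H (A : {linear H -> H}) : closed_subspace H :=
  range_closure (defect_adj A).

Lemma defect_adj_in H (A : {linear H -> H}) (h : H) :
  defect_adj A h \in csub_set (defect_space A).
Proof. by rewrite inE; apply: subset_closure; exists h. Qed.

(* D_{A^*} h as an element of the defect space. *)
Definition to_defect H (A : {linear H -> H}) (h : H) :
    subsp_type (defect_space A) :=
  SubspElem (defect_adj_in A h).

End operators.

Section canonical_projection.
Variables (R : realType) (A B C : hilbertType R) (P0 : {linear C -> C}).

Definition canonical_proj (x : hsum (hsum A B) C) : hsum (hsum A B) C :=
  ((x.1.1, 0), P0 x.2).

Let canonical_proj_linear : linear canonical_proj.
Proof.
move=> a x y; rewrite /canonical_proj.
transitivity ((a *: x.1.1 + y.1.1, a *: 0 + 0, a *: P0 x.2 + P0 y.2)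
  : hsum (hsum A B) C) => //.
rewrite scaler0 addr0; case: x y => [[p q] r] [[p1 q1] r1] /=.
by rewrite linearP.
Qed.
HB.instance Definition _ :=
  GRing.isLinear.Build _ _ _ _ canonical_proj canonical_proj_linear.

Lemma canonical_proj_orthoproj : orthoproj P0 -> orthoproj canonical_proj.
Proof.
move=> [P0P P0S]; split=> [x|x y]; last first.
  by rewrite !hsum_innerE/= P0S linear0l linear0r.
transitivity ((x.1.1, 0, P0 (P0 x.2)) : hsum (hsum A B) C) => //.
by rewrite P0P.
Qed.

End canonical_projection.

Section ando.
Variables (R : realType) (H : separableHilbertType R) (T1 T2 : {linear H -> H}).

Definition commuting_contractive_pair :=
  [/\ contractive T1, contractive T2 & forall h, T1 (T2 h) = T2 (T1 h)].

Local Notation T := (T1 \o T2 : {linear H -> H}).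
Local Notation D1 := (subsp_type (defect_space T1)).
Local Notation D2 := (subsp_type (defect_space T2)).
Local Notation DT := (subsp_type (defect_space T)).

Record pre_ando_tuple := PreAndoTuple {
  ando_space : separableHilbertType R ;
  ando_Lambda : {linear DT -> ando_space} ;
  ando_P : {linear ando_space -> ando_space} ;
  ando_U : {linear ando_space -> ando_space} ;
  ando_LambdaP : isometric ando_Lambda ;
  ando_PP : orthoproj ando_P ;
  ando_UP : unitary ando_U
}.

Definition coincide (A A' : pre_ando_tuple) :=
  exists tau : {linear ando_space A -> ando_space A'},
    [/\ unitary tau,
        forall d, tau (ando_Lambda A d) = ando_Lambda A' d,
        forall x, tau (ando_P A (adj tau x)) = ando_P A' x &
        forall x, tau (ando_U A (adj tau x)) = ando_U A' x].

Definition type_I_ando_tuple (A : pre_ando_tuple) :=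
  let Lam := ando_Lambda A in let P := ando_P A in let U := ando_U A in
  (forall h, perp P (U (Lam (to_defect T h)))
             + P (U (Lam (to_defect T (adj T h))))
             = Lam (to_defect T (adj T1 h))) /\
  (forall h, adj U (P (Lam (to_defect T h)))
             + adj U (perp P (Lam (to_defect T (adj T h))))
             = Lam (to_defect T (adj T2 h))).

(* The data of a canonical special tuple, on the space D1 (+) D2 (+) F0. Its
   isometry is determined by csa_LambdaE, the range of D_{T^*} being dense in
   DT. *)
Record canonical_special_data := CanonicalSpecialData {
  csa_F0 : separableHilbertType R ;
  csa_Lambda : {linear DT -> hsum (hsum D1 D2) csa_F0} ;
  csa_P0 : {linear csa_F0 -> csa_F0} ;
  csa_U : {linear hsum (hsum D1 D2) csa_F0 -> hsum (hsum D1 D2) csa_F0} ;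
  csa_LambdaP : isometric csa_Lambda ;
  csa_LambdaE : forall h, csa_Lambda (to_defect T h) =
    ((to_defect T1 (adj T2 h), to_defect T2 h), 0) ;
  csa_P0P : orthoproj csa_P0 ;
  csa_UP : unitary csa_U ;
  csa_UE : forall h,
    csa_U ((to_defect T1 (adj T2 h), to_defect T2 h), 0) =
    ((to_defect T1 h, to_defect T2 (adj T1 h)), 0)
}.

Definition canonical_special_tuple (c : canonical_special_data) :
    pre_ando_tuple :=
  @PreAndoTuple (hsum (hsum D1 D2) (csa_F0 c)) (csa_Lambda c)
    (@canonical_proj R D1 D2 (csa_F0 c) (csa_P0 c)) (csa_U c)
    (@csa_LambdaP c) (canonical_proj_orthoproj D1 D2 (@csa_P0P c)) (@csa_UP c).

Definition special_ando_tuple (A : pre_ando_tuple) :=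
  exists c : canonical_special_data, coincide A (canonical_special_tuple c).

Definition ando_lift (K : separableHilbertType R)
    (Pi : {linear H -> K}) (V1 V2 : {linear K -> K}) :=
  [/\ isometric Pi, isometric V1 /\ isometric V2,
      forall k, V1 (V2 k) = V2 (V1 k),
      forall h, adj V1 (Pi h) = Pi (adj T1 h) &
      forall h, adj V2 (Pi h) = Pi (adj T2 h)].

End ando.

(* Main.v *)
(* A canonical special tuple satisfies the Type I identities because
   Lambda D_{T*} h = D_{T1*} T2* h + D_{T2*} h, U Lambda D_{T*} h =
   D_{T1*} h + D_{T2*} T1* h, and P picks the first summand; the identities are
   invariant under coincidence. Such tuples exist: both sums have squared norm
   |h|^2 - |T* h|^2, so that Lambda is an isometry, and the partial isometry
   exchanging them on G = D_{T1*} + D_{T2*} extends to a unitary of G + G by the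
   Halmos dilation. The lift is Ando's: on H + l^2, each T_j lifts to
   W_j (h, u) = (T_j h, shift of u with D_{T_j} h inserted); W_1 W_2 and W_2 W_1
   differ only in the first inserted block, and a unitary E acting on blocks
   corrects this, with V_1 = E W_1 and V_2 = W_2 E^-1. *)
Require Import Defs.
From HB Require Import structures.
From mathcomp Require Import all_boot all_order all_algebra.
From mathcomp Require Import complex all_classical all_reals.
From mathcomp Require Import topology normedtype.
From mathcomp Require Import ring.
Set Implicit Arguments.
Unset Strict Implicit.
Unset Printing Implicit Defensive.
Import Order.TTheory GRing.Theory Num.Theory.
Import numFieldNormedType.Exports.
Local Open Scope classical_set_scope.
Local Open Scope complex_scope.
Local Open Scope ring_scope.

(** [adj] and [possqrt] choose an operator with a given property, so nothing is known about them
    until such an operator is exhibited: Riesz representation does this for adjoints, an iteration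
    with a scalar majorant for square roots. Afterwards the roots matter only through <D_{A^*} x,
    D_{A^*} y> = <x, y> - <A^* x, A^* y>. An isometry between two subspaces of G need not extend to
    a unitary of G, because their orthogonal complements can have different dimensions; this is what
    forces the second copy of G. Extended by zero, the isometry becomes a partial isometry W, and W
    W^*, W^* W are projections, so the corners of the dilation need no square root. The lift is
    built directly and not from a tuple. The two products are V_1 V_2 = E W_1 W_2 E^-1 and V_2 V_1 =
    W_2 W_1. In the first, E and E^-1 cancel on all blocks behind the inserted one, so that E only
    has to exchange the two versions of that block. *)

(** * Limits and completeness over the complex scalars *)

Section limits.
Variable R : realType.
Local Notation C := R[i].

(** [R[i]] is only partially ordered, so the supremum is taken over real parts; [i0] makes that set
    nonempty and shows that [M] is real. *)
Lemma near_sup (I : Type) (J : I -> C) (M : C) (i0 : I) (e : C) :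
  (forall i, J i \is Num.real) -> (forall i, J i <= M) -> 0 < e ->
  exists i, forall j, J j <= J i + e.
Proof.
move=> Jr JM e0; pose E := [set complex.Re (J i) | i in [set: I]].
have JE i : J i = (complex.Re (J i))%:C by rewrite RRe_real.
have eE : e = (complex.Re e)%:C by rewrite RRe_real ?gtr0_real.
have Mr : M \is Num.real.
  by rewrite -[M](subrK (J i0)) realD// ger0_real// subr_ge0.
have supE : has_sup E.
  split; first by exists (complex.Re (J i0)), i0.
  exists (complex.Re M) => _ [i _ <-].
  by rewrite -lecR -JE RRe_real.
have re0 : 0 < complex.Re e by rewrite -ltcR -eE.
have [_ [i _ <-] si] := sup_adherent re0 supE.
exists i => j; rewrite (JE i) (JE j) eE -rmorphD lecR -lerBlDr.
apply: ltW; apply: le_lt_trans si; rewrite lerD2r.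
by apply: (ub_le_sup supE.2); exists j.
Qed.

Section normed.
Variable V : normedZmodType C.

(** Stated for any normed Z-module over [R[i]], so that scalars and Hilbert spaces share one notion
    of limit. *)
Definition tends (u : nat -> V) (l : V) :=
  forall e : C, 0 < e -> exists N, forall n, (N <= n)%N -> `|u n - l| < e.

Definition cauchys (u : nat -> V) := forall e : C, 0 < e ->
  exists N, forall m n, (N <= m)%N -> (N <= n)%N -> `|u m - u n| < e.

Lemma norm_small_eq0 (x : V) : (forall e : C, 0 < e -> `|x| <= e) -> x = 0.
Proof.
move=> xe; apply/eqP; rewrite -normr_eq0; apply/negPn/negP => x0.
have xp : 0 < `|x| by rewrite lt_def x0/=.
have := xe _ (divr_gt0 xp (ltr0Sn _ 1)).
by rewrite {1}(splitr `|x|) gerDl lt_geF// divr_gt0.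
Qed.

End normed.

Lemma tends_lipschitz (V W : normedZmodType C) (g : V -> W) (M : C) u l :
  0 <= M -> (forall x y, `|g x - g y| <= M * `|x - y|) ->
  tends u l -> tends (g \o u) (g l).
Proof.
move=> M0 gM ul e e0; have M1 : 0 < M + 1 by rewrite ltr_wpDl.
have [N uN] := ul _ (divr_gt0 e0 M1); exists N => n /uN.
rewrite ltr_pdivlMr// => /(le_lt_trans _); apply.
rewrite (le_trans (gM _ _))// mulrC ler_wpM2l// lerDl//.
Qed.

Lemma tendsD (V : normedZmodType C) (u v : nat -> V) l m :
  tends u l -> tends v m -> tends (fun n => u n + v n) (l + m).
Proof.
move=> ul vm e e0; have e20 : 0 < e / 2 by rewrite divr_gt0.
have [N uN] := ul _ e20; have [N' vN] := vm _ e20.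
exists (maxn N N') => n; rewrite geq_max => /andP[/uN h1 /vN h2].
by rewrite opprD addrACA (le_lt_trans (ler_normD _ _))// (splitr e) ltrD.
Qed.

Lemma tends_unique (V : normedZmodType C) (u : nat -> V) l m :
  tends u l -> tends u m -> l = m.
Proof.
move=> ul um; apply/eqP; rewrite -subr_eq0; apply/eqP.
apply: norm_small_eq0 => e e0.
have e20 : 0 < e / 2 by rewrite divr_gt0.
have [N uN] := ul _ e20; have [N' vN] := um _ e20.
have := uN _ (leq_maxl N N'); have := vN _ (leq_maxr N N').
set k := maxn _ _ => h1 h2.
rewrite (le_trans (ler_distD (u k) _ _))// (splitr e) lerD// ltW//.
by rewrite distrC.
Qed.

Lemma tends_eq (V : normedZmodType C) (u v : nat -> V) l :
  u =1 v -> tends u l -> tends v l.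
Proof. by move=> /funext ->. Qed.

(** In [R[i]], [0 <= l] also says that [l] is real. Both follow from [l] being its own norm, since
    [l] and its norm are within 2 e of each other whenever some [u N] is within e of [l]. *)
Lemma tends_ge0 (u : nat -> C) l : (forall n, 0 <= u n) -> tends u l -> 0 <= l.
Proof.
move=> u0 ul; suff -> : l = `|l| by [].
apply/eqP; rewrite -subr_eq0; apply/eqP; apply: norm_small_eq0 => e e0.
have e20 : 0 < e / 2 by rewrite divr_gt0.
have [N /(_ N (leqnn N)) uN] := ul _ e20.
rewrite (le_trans (ler_distD (u N) _ _))// (splitr e) lerD// ltW//.
  by rewrite distrC.
by rewrite -[X in X - _](ger0_norm (u0 N)) (le_lt_trans (ler_dist_dist _ _)).
Qed.

Lemma tends_le (u : nat -> C) l M : (forall n, u n <= M) -> tends u l -> l <= M.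
Proof.
move=> uM ul; rewrite -subr_ge0.
apply: (@tends_ge0 (fun n => M - u n)) => [n|]; first by rewrite subr_ge0.
apply: (@tends_lipschitz C C (fun x => M - x) 1 u l ler01 _ ul) => x y.
by rewrite mul1r opprB addrC subrKA distrC.
Qed.

Lemma mono_cauchys (a : nat -> C) M : (forall n, 0 <= a n <= M) ->
  (forall n, a n <= a n.+1) -> cauchys a.
Proof.
move=> aM aS e e0; have e20 : 0 < e / 2 by rewrite divr_gt0.
(* Quarters, because [near_sup] is not strict: two distances of at most e/4 give e/2 < e. *)
have e40 : 0 < e / 2 / 2 by rewrite divr_gt0.
have [i ai] := @near_sup nat a M 0%N _ (fun n => ger0_real (andP (aM n)).1)
  (fun n => (andP (aM n)).2) e40.
have am : {homo a : x y / (x <= y)%N >-> x <= y}.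
  by apply: homo_leq => //; exact: le_trans.
have close m : (i <= m)%N -> `|a m - a i| <= e / 2 / 2.
  by move=> im; rewrite ger0_norm ?subr_ge0 ?am// lerBlDl.
exists i => m n im jn; rewrite (le_lt_trans (ler_distD (a i) _ _))//.
rewrite (@le_lt_trans _ _ (e / 2))//; last by rewrite [ltRHS]splitr ltrDl.
by rewrite [leRHS]splitr lerD ?close// distrC close.
Qed.

(** Completeness is inherited from [R]: [g] below stands for the real or the imaginary part, both
    additive and norm-decreasing. *)
Lemma complex_complete (u : nat -> C) : cauchys u -> exists l, tends u l.
Proof.
move=> uc.
have rc (g : C -> R) :
    {morph g : x y / x - y} -> (forall x, `|g x|%:C <= `|x|) ->
    exists l : R, forall e : R, 0 < e -> exists N, forall n, (N <= n)%N ->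
      `|g (u n) - l| < e.
  move=> gB gle.
  have : cauchy ((g \o u) @ \oo).
    apply/cauchy_exP => e e0.
    have e0C : 0 < e%:C by rewrite ltcR.
    have [N uN] := uc _ e0C.
    exists (g (u N)); exists N => // n /= Nn; rewrite -ball_normE /ball_/=.
    by rewrite -ltcR -gB (le_lt_trans (gle _))// uN//.
  move=> /cauchy_cvg/cvg_ex[l ul]; exists l => e e0.
  have [N _ Ne] := (@cvgrPdist_lt _ _ _ _ _ _ _).1 ul e e0.
  by exists N => n Nn; rewrite distrC; exact: Ne.
have ReB : {morph @complex.Re R : x y / x - y} by move=> [? ?] [? ?].
have ImB : {morph @complex.Im R : x y / x - y} by move=> [? ?] [? ?].
have Imle (x : C) : `|complex.Im x|%:C <= `|x|.
  rewrite -(ler_pXn2r (_ : 0 < 2)%N) ?nnegrE ?normr_ge0 ?ler0c ?normr_ge0//.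
  rewrite -add_Re2_Im2 -rmorphXn/= lecR real_normK ?num_real//.
  by rewrite lerDr sqr_ge0.
have [x xP] := rc _ ReB (@normc_ge_Re R).
have [y yP] := rc _ ImB Imle.
exists (x +i* y) => e e0; have e20 : 0 < e / 2 by rewrite divr_gt0.
have eE : e / 2 = (complex.Re (e / 2))%:C by rewrite RRe_real ?gtr0_real.
have re0 : 0 < complex.Re (e / 2) by rewrite -ltcR -eE.
have [N xN] := xP _ re0; have [N' yN] := yP _ re0.
exists (maxn N N') => n; rewrite geq_max => /andP[/xN h1 /yN h2].
rewrite (splitr e) eE [u n - _]complexE (le_lt_trans (ler_normD _ _))//.
have nR (r : R) : `|r%:C| = `|r|%:C.
  by rewrite normc_def/= expr0n/= addr0 sqrtr_sqr.
have ni : `|'i%C : C| = 1.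
  by rewrite normc_def/= expr0n expr1n/= add0r sqrtr1.
rewrite normrM ni mul1r ltrD// nR ltcR.
  by move: h1; case: (u n).
by move: h2; case: (u n).
Qed.

Lemma hilbert_complete (V : completeNormedModType C) (u : nat -> V) :
  cauchys u -> exists l, tends u l.
Proof.
move=> uc.
have : cauchy (u @ \oo).
  apply/cauchy_exP => e e0; have [N uN] := uc e e0.
  by exists (u N); exists N => // n /= Nn; rewrite -ball_normE /ball_/= uN.
move=> /cauchy_cvg/cvg_ex[l ul]; exists l => e e0.
have [N _ Ne] := (@cvgrPdist_lt _ _ _ _ _ _ _).1 ul e e0.
by exists N => n Nn; rewrite distrC; exact: Ne.
Qed.

End limits.

(** * Polarization, inner product calculus and Riesz representation *)

Section sesquilinear.
Variable R : realType.
Local Notation C := R[i].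

(** Polarization: expanding at [x + y] gives q x y = - q y x, and at i x + y gives q x y = q y x.
    Applied to differences of two forms, it lifts identities from the diagonal. *)
Lemma sesquilinear_eq0 (V : lmodType C) (q : V -> V -> C) :
  (forall a x y z, q (a *: x + y) z = a * q x z + q y z) ->
  (forall a x y z, q z (a *: x + y) = a^* * q z x + q z y) ->
  (forall x, q x x = 0) -> forall x y, q x y = 0.
Proof.
move=> ql qr q0 x y.
have e1 : q x y = - q y x.
  apply/eqP; rewrite -addr_eq0; apply/eqP.
  by have := q0 (1 *: x + y); rewrite ql !qr rmorph1 !mul1r !q0 add0r addr0.
have := q0 ('i *: x + y); rewrite ql !qr !q0 conjCi mulr0 add0r addr0.
rewrite e1 mulrN mulNr -opprD -mulr2n => /eqP.
rewrite oppr_eq0 mulrn_eq0/= mulf_eq0 (negPf (neq0Ci _))/= => /eqP ->.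
by rewrite oppr0.
Qed.

Lemma linear_pack (V W : lmodType C) (f : V -> W) :
  linear f -> exists g : {linear V -> W}, g =1 f.
Proof.
move=> lf.
by exists (HB.pack_for {linear V -> W} f
  (GRing.isLinear.Build C V W *:%R f lf)).
Qed.

(* A constant without canonical structures in its head, so that rewriting finds
   its instances. *)
Definition ip (H : hilbertType R) (x y : H) : C := '[x, y].

Section ip_theory.
Variable H : hilbertType R.
Implicit Types x y z : H.

Lemma ipPl a x y z : ip (a *: x + y) z = a * ip x z + ip y z.
Proof. by rewrite /ip linearDl linearZl_LR. Qed.
Lemma ipPr a x y z : ip z (a *: x + y) = a^* * ip z x + ip z y.
Proof. by rewrite /ip linearDr linearZr_LR. Qed.
Lemma ipDl x y z : ip (x + y) z = ip x z + ip y z.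
Proof. by rewrite /ip linearDl. Qed.
Lemma ipDr x y z : ip z (x + y) = ip z x + ip z y.
Proof. by rewrite /ip linearDr. Qed.
Lemma ipBl x y z : ip (x - y) z = ip x z - ip y z.
Proof. by rewrite /ip linearBl. Qed.
Lemma ipBr x y z : ip z (x - y) = ip z x - ip z y.
Proof. by rewrite /ip linearBr. Qed.
Lemma ipZl a x z : ip (a *: x) z = a * ip x z.
Proof. by rewrite /ip linearZl_LR. Qed.
Lemma ipZr a x z : ip z (a *: x) = a^* * ip z x.
Proof. by rewrite /ip linearZr_LR. Qed.
Lemma ip0l z : ip (0 : H) z = 0.
Proof. by rewrite /ip linear0l. Qed.
Lemma ip0r z : ip z (0 : H) = 0.
Proof. by rewrite /ip linear0r. Qed.

Lemma ip_conj x y : (ip x y)^* = ip y x.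
Proof. by rewrite /ip [RHS]hermC expr0 mul1r. Qed.

Lemma ip_norm x : ip x x = `|x| ^+ 2.
Proof. by rewrite /ip sqr_norm_inner. Qed.

Lemma ip_ext x y : (forall z, ip z x = ip z y) -> x = y.
Proof.
move=> xy; apply/eqP; rewrite -subr_eq0 -normr_eq0 -sqrf_eq0 -ip_norm.
by rewrite ipBr xy subrr.
Qed.

Lemma ip_le (u v : H) : `|ip u v| <= `|u| * `|v|.
Proof.
have [->|v0] := eqVneq v 0.
  by rewrite ip0r normr0 mulr_ge0.
have vv0 : 0 < `|v| ^+ 2 by rewrite exprn_gt0// normr_gt0.
(* [a *: v] is the projection of [u] on the line of [v]; by Pythagoras it is no longer than [u]. *)
pose a := ip u v / `|v| ^+ 2.
have ou : ip (u - a *: v) v = 0.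
  by rewrite ipBl ipZl ip_norm divfK ?subrr ?gt_eqF.
have uu : `|u| ^+ 2 = `|u - a *: v| ^+ 2 + `|a| ^+ 2 * `|v| ^+ 2.
  rewrite -!ip_norm -{1 2}(subrK (a *: v) u); move: (u - _) ou => d ou.
  rewrite ipDl !ipDr !ipZr !ipZl ou -(ip_conj d v) ou conjC0 !mulr0 addr0 add0r.
  by rewrite mulrA normCK [a^* * _]mulrC.
have : `|a| ^+ 2 * `|v| ^+ 2 <= `|u| ^+ 2 by rewrite uu lerDr exprn_ge0.
rewrite -(ler_pM2r vv0) -mulrA -expr2 -exprMn normf_div (ger0_norm (ltW vv0)).
rewrite divfK ?gt_eqF// -exprMn => h.
by rewrite -(ler_pXn2r (_ : 0 < 2)%N)// ?nnegrE ?mulr_ge0.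
Qed.

End ip_theory.

Lemma norm_ipP (H K : hilbertType R) (x : H) (y : K) :
  ip x x = ip y y -> `|x| = `|y|.
Proof.
by rewrite !ip_norm => xy; apply: (pexpIrn (_ : 0 < 2)%N); rewrite ?nnegrE.
Qed.

(* J z = 2 Re (f z) - |z|^2 is bounded above. If z maximizes J up to e^2, then
   perturbing z along w gives |f w - <w, z>| <= e |w|; hence near-maximizers
   form a Cauchy sequence, and its limit represents f. *)
Lemma riesz (H : hilbertType R) (f : H -> C) (M : C) :
  (forall a x y, f (a *: x + y) = a * f x + f y) ->
  0 <= M -> (forall x, `|f x| <= M * `|x|) ->
  exists z, forall w, f w = ip w z.
Proof.
move=> fl M0 fM.
have f0 : f 0 = 0.
  by apply/eqP; rewrite -normr_le0 (le_trans (fM _))// normr0 mulr0.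
pose J z : C := f z + (f z)^* - `|z| ^+ 2.
have Jr z : J z \is Num.real.
  rewrite /J realB// ?realX ?normr_real//.
  by rewrite CrealE rmorphD/= conjCK addrC.
have JM z : J z <= M ^+ 2.
  have h : f z + (f z)^* <= (M * `|z|) *+ 2.
    have := (leif_Re_Creal (f z)).1; rewrite ReE ler_pdivrMr// => h.
    by rewrite (le_trans h)// mulr_natr lerMn2r fM.
  rewrite lerBlDr (le_trans h)// -subr_ge0.
  rewrite (_ : _ - _ = (M - `|z|) ^+ 2); last by rewrite sqrrB addrAC.
  by rewrite real_exprn_even_ge0// realB ?ger0_real.
have near z (e : C) : 0 < e -> (forall z', J z' <= J z + e ^+ 2) ->
    forall w, `|f w - ip w z| <= e * `|w|.
  move=> e0 Jz w; have [->|w0] := eqVneq w 0.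
    by rewrite f0 ip0l subrr !normr0 mulr0.
  have nw : 0 < `|w| ^+ 2 by rewrite exprn_gt0 ?normr_gt0.
  set c := f w - ip w z.
  (* Moving to s w + z changes J by 2 Re (s c) - |s|^2 |w|^2; this [s] maximizes the gain, which is
     then |c|^2 / |w|^2 and at most e^2. *)
  pose s := c^* / `|w| ^+ 2.
  have := Jz (s *: w + z).
  have -> : J (s *: w + z) = J z + (s * c + (s * c)^* - s * s^* * `|w| ^+ 2).
    rewrite /J fl -!ip_norm ipPl !ipPr -(ip_conj w z) /c mulrBr.
    rewrite !rmorphD/= rmorphN/= !rmorphM/=.
    ring.
  rewrite lerD2l.
  have -> : s * c = `|c| ^+ 2 / `|w| ^+ 2.
    by rewrite /s mulrAC [_ * c]mulrC -normCK.
  have -> : s * s^* * `|w| ^+ 2 = `|c| ^+ 2 / `|w| ^+ 2.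
    rewrite /s rmorphM/= conjCK fmorphV/= (conj_Creal (realX _ (normr_real _))).
    by rewrite normCK; field; rewrite normr_eq0.
  rewrite conj_Creal ?realM ?realV ?realX ?normr_real// addrK.
  rewrite ler_pdivrMr// -exprMn => h.
  by rewrite -(ler_pXn2r (_ : 0 < 2)%N) ?nnegrE ?mulr_ge0// ltW.
have e0 n : 0 < n.+1%:R^-1 :> C by rewrite invr_gt0 ltr0Sn.
have /choice[z zP] : forall n, exists z, forall w : H,
    `|f w - ip w z| <= n.+1%:R^-1 * `|w|.
  move=> n.
  have [z Jz] := @near_sup R H J _ 0 _ Jr JM (exprn_gt0 2 (e0 n)).
  by exists z; exact: near.
(* For w = z m - z n, |w|^2 = <w, z m> - <w, z n>, and both terms are close to f w. *)
have zc m n : `|z m - z n| <= m.+1%:R^-1 + n.+1%:R^-1.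
  set w := z m - z n; have [->|w0] := eqVneq w 0.
    by rewrite normr0 addr_ge0// ltW.
  have nw : 0 < `|w| by rewrite normr_gt0.
  rewrite -(ler_pM2r nw) -expr2 -ip_norm -(ger0_norm (_ : 0 <= ip w w));
    last by rewrite ip_norm exprn_ge0.
  rewrite {2}/w ipBr mulrDl (le_trans (ler_distD (f w) _ _))// lerD//.
  by rewrite distrC.
have zcauchy : cauchys z.
  move=> e ep; have [N Ne] := invS_lt_complex (divr_gt0 ep (ltr0Sn _ 1)).
  have le_inv m : (N <= m)%N -> m.+1%:R^-1 <= N.+1%:R^-1 :> C.
    by move=> Nm; rewrite lef_pV2 ?posrE ?ltr0Sn// ler_nat.
  exists N => m n Nm Nn; rewrite (le_lt_trans (zc m n))// (splitr e).
  by rewrite ltrD// (le_lt_trans _ Ne)// le_inv.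
have [l zl] := hilbert_complete zcauchy.
exists l => w; apply/eqP; rewrite -subr_eq0; apply/eqP.
apply: norm_small_eq0 => e ep.
have w1 : 0 < `|w| + 1 by rewrite ltr_wpDl.
have ew : 0 < e / 2 / (`|w| + 1) by rewrite !divr_gt0.
have [N zN] := zl _ ew; have [N' eN'] := invS_lt_complex ew.
set k := maxn N N'.
have ek : k.+1%:R^-1 <= e / 2 / (`|w| + 1).
  rewrite (le_trans _ (ltW eN'))// lef_pV2 ?posrE ?ltr0Sn//.
  by rewrite ler_nat ltnS leq_maxr.
rewrite (le_trans (ler_distD (ip w (z k)) _ _))// (splitr e) lerD//.
  rewrite (le_trans (zP _ _))// (le_trans (ler_wpM2r _ ek))//.
  by rewrite -[leRHS](divfK (lt0r_neq0 w1)) ler_wpM2l ?lerDl// ltW.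
rewrite -ipBr (le_trans (ip_le _ _))// mulrC.
rewrite (le_trans (ler_wpM2r _ (ltW (zN _ (leq_maxl _ _)))))//.
by rewrite -[leRHS](divfK (lt0r_neq0 w1)) ler_wpM2l ?lerDl// ltW.
Qed.
End sesquilinear.

(** * Adjoints of bounded operators *)

Section adjoint.
Variable R : realType.
Local Notation C := R[i].
Implicit Types H K : hilbertType R.

Lemma selectP (T : Type) (x0 : T) (P : T -> Prop) :
  (exists x, P x) -> P (select x0 P).
Proof.
by rewrite /select; case: pselect => // e _; exact: svalP (cid e).
Qed.

Definition bounded_op H K (A : H -> K) :=
  exists2 M : C, 0 <= M & forall x, `|A x| <= M * `|x|.

(** Riesz represents x |-> <A x, y> by a vector [b y]; uniqueness of that vector makes [b] linear,
    so the choice in [adj] has a candidate. *)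
Lemma adjP H K (A : {linear H -> K}) : bounded_op A ->
  forall x y, ip (A x) y = ip x (adj A y).
Proof.
move=> [M M0 AM].
apply: (@selectP _ _ (fun B : {linear K -> H} =>
  forall x y, ip (A x) y = ip x (B y))).
have /choice[b bP] : forall y, exists z, forall x, ip (A x) y = ip x z.
  move=> y.
  apply: (@riesz _ H _ (M * `|y|)) => [a u v||x].
  - by rewrite linearP ipPl.
  - by rewrite mulr_ge0.
  - by rewrite (le_trans (ip_le _ _))// mulrAC ler_wpM2r.
have [|B BE] := @linear_pack _ K H b.
  by move=> a x y; apply: ip_ext => z; rewrite -bP !ipPr -!bP.
by exists B => x y; rewrite BE bP.
Qed.

Lemma adj_eq H K (A : {linear H -> K}) (B : K -> H) :
  bounded_op A -> (forall x y, ip (A x) y = ip x (B y)) -> adj A =1 B.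
Proof. by move=> Ab AB y; apply: ip_ext => x; rewrite -adjP// AB. Qed.

Lemma adjPr H K (A : {linear H -> K}) : bounded_op A ->
  forall x y, ip (adj A y) x = ip y (A x).
Proof. by move=> Ab x y; rewrite -ip_conj -adjP// ip_conj. Qed.

(** |A^* y|^2 = <A A^* y, y> <= M |A^* y| |y|, and one factor cancels. *)
Lemma bounded_adj_le H K (A : {linear H -> K}) M : 0 <= M ->
  (forall x, `|A x| <= M * `|x|) -> forall y, `|adj A y| <= M * `|y|.
Proof.
move=> M0 AM y; have [->|n0] := eqVneq (adj A y) 0.
  by rewrite normr0 mulr_ge0.
have np : 0 < `|adj A y| by rewrite normr_gt0.
rewrite -(ler_pM2r np) -expr2 -ip_norm -adjP; last by exists M.
rewrite -(ger0_norm (_ : 0 <= ip _ y)); last first.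
  by rewrite adjP ?ip_norm ?exprn_ge0//; exists M.
by rewrite (le_trans (ip_le _ _))// mulrAC ler_wpM2r.
Qed.

Lemma bounded_adj H K (A : {linear H -> K}) :
  bounded_op A -> bounded_op (adj A).
Proof. by move=> [M M0 AM]; exists M => //; exact: bounded_adj_le. Qed.

Lemma adjK H K (A : {linear H -> K}) : bounded_op A -> adj (adj A) =1 A.
Proof.
by move=> Ab; apply: adj_eq; [exact: bounded_adj|move=> x y; exact: adjPr].
Qed.

Lemma contractive_bounded H K (A : {linear H -> K}) :
  contractive A -> bounded_op A.
Proof. by move=> Ac; exists 1 => // x; rewrite mul1r. Qed.

Lemma contractive_adj H K (A : {linear H -> K}) :
  contractive A -> contractive (adj A).
Proof.
move=> Ac y; rewrite -[leRHS]mul1r; apply: bounded_adj_le => // x.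
by rewrite mul1r.
Qed.

Lemma isometric_contractive H K (A : {linear H -> K}) :
  isometric A -> contractive A.
Proof. by move=> Ai x; rewrite Ai. Qed.

Lemma isometric_ip H K (A : {linear H -> K}) : isometric A ->
  forall x y, ip (A x) (A y) = ip x y.
Proof.
move=> Ai x y; apply/eqP; rewrite -subr_eq0; apply/eqP.
apply: (@sesquilinear_eq0 _ _ (fun x y => ip (A x) (A y) - ip x y)).
- by move=> a u v w; rewrite linearP !ipPl mulrBr opprD addrACA.
- by move=> a u v w; rewrite linearP !ipPr mulrBr opprD addrACA.
- by move=> u; rewrite !ip_norm Ai subrr.
Qed.

Lemma isometric_adjK H K (A : {linear H -> K}) : isometric A ->
  forall x, adj A (A x) = x.
Proof.
move=> Ai x; have Ab := contractive_bounded (isometric_contractive Ai).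
by apply: ip_ext => z; rewrite -adjP// isometric_ip.
Qed.

Lemma unitary_adjKV H K (A : {linear H -> K}) : unitary A ->
  forall x, A (adj A x) = x.
Proof. by move=> [Ai As] y; have [x <-] := As y; rewrite isometric_adjK. Qed.

Lemma isometricP H K (A : {linear H -> K}) : bounded_op A ->
  (forall x, adj A (A x) = x) -> isometric A.
Proof. by move=> Ab AA x; apply: norm_ipP; rewrite adjP// AA. Qed.

End adjoint.

(** * Positive square roots and defect operators *)

Section square_root.
Variable R : realType.
Local Notation C := R[i].
Implicit Types H K : hilbertType R.

Lemma lipschitz_continuous H K (S : {linear H -> K}) :
  bounded_op S -> continuous S.
Proof.
move=> [M M0 SM] x; apply/cvgrPdist_lt => e e0.
have M1 : 0 < M + 1 by rewrite ltr_wpDl.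
apply/nbhs_ballP; exists (e / (M + 1)); first by rewrite /= divr_gt0.
move=> y; rewrite -ball_normE /ball_/= ltr_pdivlMr// => xy.
rewrite -linearB (le_lt_trans (SM _))// (le_lt_trans _ xy)// mulrC.
by rewrite ler_wpM2l// lerDl.
Qed.

Section iteration.
Variables (H : hilbertType R) (B : {linear H -> H}).
Hypotheses (Bc : contractive B) (Bs : forall x y, ip (B x) y = ip x (B y)).

(* sqrt_iter n = p_n(B) for a polynomial p_n with nonnegative coefficients and
   majorant n = p_n(1); the limit of sqrt_iter is I - (I - B)^(1/2). *)
Fixpoint majorant n : C :=
  if n is m.+1 then (1 + majorant m ^+ 2) / 2 else 0.

Fixpoint sqrt_iter n (x : H) : H :=
  if n is m.+1 then 2^-1 *: (B x + sqrt_iter m (sqrt_iter m x)) else 0.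

Local Notation a := majorant.
Local Notation Y := sqrt_iter.

Lemma majorant_ge0 n : 0 <= a n.
Proof.
by elim: n => //= n an; rewrite divr_ge0// addr_ge0// exprn_ge0.
Qed.

Lemma majorant_le1 n : a n <= 1.
Proof.
elim: n => [|n an]/=; first exact: ler01.
rewrite ler_pdivrMr// mul1r [leRHS](_ : 2 = 1 + 1)// lerD2l.
by rewrite exprn_ile1// majorant_ge0.
Qed.

Lemma majorantS n : a n <= a n.+1.
Proof.
elim: n => [|n an]; first by rewrite /= divr_ge0// addr_ge0// exprn_ge0.
have an0 := majorant_ge0; rewrite [leRHS]/((1 + a n.+1 ^+ 2) / 2) [leLHS]/=.
by rewrite ler_pM2r ?invr_gt0// lerD2l lerXn2r ?nnegrE ?an0.
Qed.

Lemma sqrt_iter_linear n : linear (Y n).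
Proof.
elim: n => [|n Yn] c x y; first by rewrite /= scaler0 addr0.
rewrite /= linearP !Yn addrACA -scalerDr [LHS]scalerDr.
by rewrite !scalerA [c * _]mulrC.
Qed.

Lemma sqrt_iterB n x y : Y n (x - y) = Y n x - Y n y.
Proof.
by rewrite addrC -scaleN1r sqrt_iter_linear scaleN1r addrC.
Qed.

Lemma sqrt_iter_sym n x y : ip (Y n x) y = ip x (Y n y).
Proof.
elim: n x y => [|n Yn] x y; first by rewrite /= ip0l ip0r.
by rewrite /= ipZl ipZr ipDl ipDr Bs !Yn fmorphV rmorph_nat.
Qed.

Lemma sqrt_iter_le n x : `|Y n x| <= a n * `|x|.
Proof.
elim: n x => [|n Yn] x; first by rewrite /= normr0 mul0r.
rewrite /= normrZ gtr0_norm ?invr_gt0// mulrC mulrAC ler_pM2r ?invr_gt0//.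
rewrite mulrDl mul1r (le_trans (ler_normD _ _))// lerD ?Bc//.
by rewrite (le_trans (Yn _))// expr2 -mulrA ler_wpM2l// majorant_ge0.
Qed.

(** An increment is half a difference of squares. The splitting Y_{n+1} (Y_{n+1} - Y_n) + (Y_{n+1} -
    Y_n) Y_n is valid without commuting the iterates, and the majorants satisfy the same identity,
    so the bounds match term by term. *)
Lemma sqrt_iterS_le n x : `|Y n.+1 x - Y n x| <= (a n.+1 - a n) * `|x|.
Proof.
elim: n x => [|n Yn] x.
  by have := sqrt_iter_le 1 x; rewrite /= !subr0.
have -> : Y n.+2 x - Y n.+1 x =
    2^-1 *: (Y n.+1 (Y n.+1 x - Y n x) + (Y n.+1 (Y n x) - Y n (Y n x))).
  rewrite sqrt_iterB subrKA.
  rewrite [Y n.+2 x]/(2^-1 *: (B x + Y n.+1 (Y n.+1 x))).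
  rewrite [X in _ - X = _]/(2^-1 *: (B x + Y n (Y n x))).
  by rewrite -scalerBr opprD addrACA subrr add0r.
have -> : a n.+2 - a n.+1 =
    2^-1 * (a n.+1 * (a n.+1 - a n) + (a n.+1 - a n) * a n).
  have aS m : a m.+1 = (1 + a m ^+ 2) / 2 by [].
  rewrite (aS n.+1) [X in _ - X = _]aS.
  move: (a n.+1) (a n) => b c.
  by field.
rewrite normrZ gtr0_norm ?invr_gt0// -mulrA ler_pM2l ?invr_gt0//.
rewrite (le_trans (ler_normD _ _))// mulrDl lerD//.
  rewrite (le_trans (sqrt_iter_le _ _))// -mulrA ler_wpM2l ?majorant_ge0//.
rewrite (le_trans (Yn _))// -mulrA ler_wpM2l ?subr_ge0 ?majorantS//.
exact: sqrt_iter_le.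
Qed.

Lemma majorant_cauchy : cauchys a.
Proof.
by apply: (@mono_cauchys _ _ 1); [move=> n; rewrite majorant_ge0 majorant_le1|
  exact: majorantS].
Qed.

Lemma sqrt_iter_dist m n x :
  `|Y m x - Y n x| <= `|a m - a n| * `|x|.
Proof.
wlog nm : m n / (n <= m)%N.
  move=> h; case: (leqP n m) => [|/ltnW] /h//.
  by rewrite distrC [in leRHS]distrC.
have am : {homo a : x y / (x <= y)%N >-> x <= y}.
  by apply: homo_leq => //; [exact: le_trans|exact: majorantS].
rewrite (ger0_norm (_ : 0 <= a m - a n)) ?subr_ge0 ?am//.
elim: m nm => [|m IH].
  by rewrite leqn0 => /eqP ->; rewrite !subrr normr0 mul0r.
rewrite leq_eqVlt => /orP[/eqP ->|]; first by rewrite !subrr normr0 mul0r.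
rewrite ltnS => /IH nm.
rewrite (le_trans (ler_distD (Y m x) _ _))//.
by rewrite -[X in X * _](subrKA (a m)) mulrDl lerD// sqrt_iterS_le.
Qed.

(** The last clause is the fixed point equation L = (B + L^2) / 2, that is, (I - L)^2 = I - B. *)
Lemma sqrt_iter_lim : exists L : {linear H -> H},
  [/\ contractive L, forall x y, ip (L x) y = ip x (L y) &
      forall x, L (L x) = 2 *: L x - B x].
Proof.
have /choice[l lP] : forall x, exists z, tends (fun n => Y n x) z.
  move=> x; apply: hilbert_complete => e e0.
  have x1 : 0 < `|x| + 1 by rewrite ltr_wpDl.
  have [N aN] := majorant_cauchy (divr_gt0 e0 x1).
  exists N => m n Nm Nn; rewrite (le_lt_trans (sqrt_iter_dist _ _ _))//.
  have := aN _ _ Nm Nn; rewrite ltr_pdivlMr//; apply: le_lt_trans.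
  by rewrite ler_wpM2l// lerDl.
have [L LE] : exists g : {linear H -> H}, g =1 l.
  apply: linear_pack => c x y; apply: tends_unique (lP _) _.
  apply: tends_eq; last first.
    apply: tendsD (lP y).
    apply: (tends_lipschitz (normr_ge0 c)) (lP x) => u v.
    by rewrite -scalerBr normrZ.
  by move=> n /=; rewrite sqrt_iter_linear.
have Lt x : tends (fun n => Y n x) (L x) by rewrite LE.
have Lc : contractive L.
  move=> x.
  apply: (@tends_le _ (fun n => `|Y n x|)) => [n|].
    by rewrite (le_trans (sqrt_iter_le _ _))// ler_piMl// majorant_le1.
  apply: (@tends_lipschitz _ _ _ (fun z : H => `|z|) 1 _ _ ler01) (Lt x) => u v.
  by rewrite mul1r ler_dist_dist.
have ip_lip (z : H) : forall u v, `|ip u z - ip v z| <= `|z| * `|u - v|.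
  by move=> u v; rewrite -ipBl mulrC ip_le.
exists L; split => // [x y|x].
  apply: tends_unique (tends_lipschitz (normr_ge0 y) (ip_lip y) (Lt x)) _.
  apply: tends_eq (_ : tends (fun n => ip x (Y n y)) _).
    by move=> n /=; rewrite sqrt_iter_sym.
  apply: (@tends_lipschitz _ _ _ (fun z : H => ip x z) `|x|) (Lt y) => // u v.
  by rewrite -ipBr ip_le.
(* Two limits of Y_n Y_n x are compared: contractivity of the Y_n gives L L x, and the recursion
   rewrites the sequence as 2 Y_{n+1} x - B x. *)
apply: (@tends_unique _ _ (fun n => Y n (Y n x))).
  move=> e e0; have e20 : 0 < e / 2 by rewrite divr_gt0.
  have [N xN] := Lt x _ e20; have [N' yN] := Lt (L x) _ e20.
  exists (maxn N N') => n; rewrite geq_max => /andP[/xN h1 /yN h2].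
  rewrite (le_lt_trans (ler_distD (Y n (L x)) _ _))// (splitr e) ltrD//.
  rewrite -sqrt_iterB (le_lt_trans (sqrt_iter_le _ _))// (le_lt_trans _ h1)//.
  by rewrite ler_piMl// majorant_le1.
have Yt : tends (fun n => 2 *: Y n.+1 x - B x) (2 *: L x - B x).
  apply: (@tends_lipschitz _ _ _ (fun z : H => 2 *: z - B x) 2
    (fun n => Y n.+1 x)) => // [u v|e e0].
    by rewrite opprB subrKA -scalerBr normrZ gtr0_norm.
  have [N xN] := Lt x _ e0; exists N => n Nn; apply: xN.
  exact: leqW.
apply: tends_eq Yt => n /=.
by rewrite scalerA divff ?pnatr_eq0// scale1r addrC addKr.
Qed.

End iteration.

(** The root exhibited is I - L, positive because L is a symmetric contraction. Symmetry of the
    chosen root comes from its positivity: its quadratic form is real, and polarization does the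
    rest. *)
Lemma possqrtP H (A : H -> H) (B : {linear H -> H}) : contractive B ->
  (forall x y, ip (B x) y = ip x (B y)) -> (forall x, A x = x - B x) ->
  (forall x y, ip (possqrt A x) y = ip x (possqrt A y)) /\
  (forall x, possqrt A (possqrt A x) = A x).
Proof.
move=> Bc Bs AE.
suff ex : exists S : {linear H -> H},
    [/\ continuous S, forall x, 0 <= '[S x, x] & forall x, S (S x) = A x].
  have [_ S0 SS] := @selectP {linear H -> H} \0 _ ex.
  split=> // x y; apply/eqP; rewrite -subr_eq0; apply/eqP.
  apply: (@sesquilinear_eq0 _ _
    (fun x y => ip (possqrt A x) y - ip x (possqrt A y))).
  - by move=> a u v w; rewrite linearP !ipPl mulrBr opprD addrACA.
  - by move=> a u v w; rewrite linearP !ipPr mulrBr opprD addrACA.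
  - move=> u; rewrite -[X in _ - X]ip_conj conj_Creal ?subrr//.
    exact: ger0_real (S0 u).
have [L [Lc Ls LL]] := sqrt_iter_lim Bc Bs.
have [S SE] : exists g : {linear H -> H}, g =1 (fun x => x - L x).
  apply: linear_pack => c x y.
  by rewrite linearP scalerBr opprD addrACA.
exists S; split=> [|x|x].
- apply: lipschitz_continuous; exists 2 => // x.
  by rewrite SE (le_trans (ler_normB _ _))// mulrDl mul1r lerD// Lc.
- change (0 <= ip (S x) x); rewrite SE ipBl subr_ge0 ip_norm.
  have Lr : ip (L x) x \is Num.real by rewrite CrealE ip_conj Ls.
  rewrite (le_trans (real_ler_norm Lr))// (le_trans (ip_le _ _))//.
  by rewrite expr2 ler_wpM2r.
- rewrite !SE AE linearB/= LL scaler_nat mulr2n.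
  by rewrite opprB [_ - B x - _]addrAC addrK subrKA.
Qed.

Lemma defect_adjP H (T : {linear H -> H}) : contractive T ->
  (forall x y, ip (defect_adj T x) y = ip x (defect_adj T y)) /\
  (forall x, defect_adj T (defect_adj T x) = x - T (adj T x)).
Proof.
move=> Tc; have Tb := contractive_bounded Tc.
apply: (@possqrtP _ _ (T \o adj T : {linear H -> H})) => // [x|x y] /=.
  by rewrite (le_trans (Tc _))// contractive_adj.
by rewrite adjP// adjPr.
Qed.

(** This removes the square root from all later computations: norms of defect vectors become
    differences of squared norms. *)
Lemma defect_adj_ip H (T : {linear H -> H}) : contractive T ->
  forall x y, ip (defect_adj T x) (defect_adj T y) =
    ip x y - ip (adj T x) (adj T y).
Proof.
move=> Tc x y; have [Ds DD] := defect_adjP Tc.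
by rewrite Ds DD ipBr -adjPr//; exact: contractive_bounded.
Qed.

End square_root.

(** * Partial isometries and their extensions *)

Section partial_isometry.
Variable R : realType.
Local Notation C := R[i].
Implicit Types H K : hilbertType R.

Lemma ip_hsum H K (u v : hsum H K) : ip u v = ip u.1 v.1 + ip u.2 v.2.
Proof. by []. Qed.

Lemma ip_pythagD H (u v : H) :
  ip u v = 0 -> ip (u + v) (u + v) = ip u u + ip v v.
Proof.
by move=> uv; rewrite ipDl !ipDr -(ip_conj u v) uv conjC0 add0r addr0.
Qed.

Lemma ip_pythagB H (u v : H) :
  ip u v = 0 -> ip (u - v) (u - v) = ip u u + ip v v.
Proof.
by move=> uv; rewrite ipBl !ipBr -(ip_conj u v) uv conjC0 subr0 sub0r opprK.
Qed.

(* Let p1, p2 be the coordinate maps on the closure of the graph of X h |-> Y h.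
   Both are isometries up to the factor sqrt 2, so that W = 2 p2 p1^* works, and
   no extension by continuity is needed. *)
Lemma partial_isometry H K1 K2 (X : {linear H -> K1}) (Y : {linear H -> K2}) :
  (forall h, `|X h| = `|Y h|) ->
  exists W : {linear K1 -> K2}, [/\ bounded_op W, forall h, W (X h) = Y h,
    forall x, W (adj W (W x)) = W x & forall h, adj W (W (X h)) = X h].
Proof.
move=> XY.
have [G GE] : exists G : {linear H -> hsum K1 K2}, G =1 (fun h => (X h, Y h)).
  by apply: linear_pack => a x y; rewrite !linearP.
pose M := range_closure G.
have MG h : G h \in csub_set M by rewrite inE; apply: subset_closure; exists h.
have n12 (m : subsp_type M) : `|(val m).1| = `|(val m).2|.
  case: m => m /=; rewrite inE => /closure_normP mG.
  apply/eqP; rewrite -subr_eq0; apply/eqP; apply: norm_small_eq0 => e e0.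
  have [_ [h _ <-] mh] := mG _ (divr_gt0 e0 (ltr0Sn _ 1)).
  have := hsum_norm1 (m - G h); have := hsum_norm2 (m - G h).
  rewrite GE /= => h2 h1.
  rewrite (le_trans (ler_distD `|X h| _ _))// (splitr e) lerD//.
    by rewrite (le_trans (ler_dist_dist _ _))// (le_trans h1)// ltW// -GE.
  rewrite XY distrC (le_trans (ler_dist_dist _ _))// (le_trans h2)// ltW//.
  by rewrite -GE.
have [p1 p1E] : exists p : {linear subsp_type M -> K1},
    p =1 (fun m => (val m).1).
  by apply: linear_pack => a x y.
have [p2 p2E] : exists p : {linear subsp_type M -> K2},
    p =1 (fun m => (val m).2).
  by apply: linear_pack => a x y.
have ip_val (m m' : subsp_type M) :
    ip m m' = ip (val m).1 (val m').1 + ip (val m).2 (val m').2 by [].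
have sqr1 m : `|p1 m| ^+ 2 = 2^-1 * `|m| ^+ 2.
  rewrite p1E -[in RHS]ip_norm ip_val !ip_norm n12 -mulr2n.
  by rewrite -[X in _ * X]mulr_natl mulKf ?pnatr_eq0.
have sqr2 m : `|p2 m| ^+ 2 = 2^-1 * `|m| ^+ 2.
  by rewrite -sqr1 p1E p2E n12.
have adjpK K (p : {linear subsp_type M -> K}) :
    (forall m, `|p m| ^+ 2 = 2^-1 * `|m| ^+ 2) ->
    bounded_op p /\ forall m, adj p (p m) = 2^-1 *: m.
  move=> psqr.
  have pb : bounded_op p.
    exists 1 => // m; rewrite mul1r -(ler_pXn2r (_ : 0 < 2)%N) ?nnegrE// psqr.
    by rewrite ler_piMl ?exprn_ge0// invf_le1// ler1n.
  split=> // m; apply: ip_ext => z; rewrite -adjP// ipZr fmorphV rmorph_nat.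
  apply/eqP; rewrite -subr_eq0; apply/eqP; move: z m.
  apply: (@sesquilinear_eq0 _ _ (fun z m => ip (p z) (p m) - 2^-1 * ip z m)).
  - by move=> a u v w; rewrite linearP !ipPl; ring.
  - by move=> a u v w; rewrite linearP !ipPr; ring.
  - by move=> u; rewrite !ip_norm psqr subrr.
have [p1b p1K] := adjpK _ _ sqr1; have [p2b p2K] := adjpK _ _ sqr2.
(* The factor 2 cancels p1^* p1 = 1/2, so [W] carries [p1 m] to [p2 m]; on the orthogonal complement
   of the range of [p1] it is zero. *)
have [W WE] : exists W : {linear K1 -> K2}, W =1 (fun x => 2 *: p2 (adj p1 x)).
  by apply: linear_pack => a x y; rewrite !linearP.
have Wb : bounded_op W.
  have [M1 M10 M1P] := bounded_adj p1b; have [M2 M20 M2P] := p2b.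
  exists (2 * (M2 * M1)) => [|x]; first by rewrite !mulr_ge0.
  rewrite WE normrZ gtr0_norm// -!mulrA ler_pM2l//.
  by rewrite (le_trans (M2P _))// ler_wpM2l.
have two : (2 != 0 :> C) by rewrite pnatr_eq0.
have adjW : adj W =1 (fun y => 2 *: p1 (adj p2 y)).
  apply: adj_eq => // x z.
  by rewrite WE ipZl ipZr rmorph_nat adjP// adjPr.
exists W; split => // [h|x|h].
- pose m : subsp_type M := SubspElem (MG h).
  have -> : X h = p1 m by rewrite p1E /= GE.
  by rewrite WE p1K linearZ/= scalerA divff// scale1r p2E /= GE.
- rewrite adjW !WE !linearZ/= p1K !linearZ/= p2K !linearZ/= !scalerA.
  by congr (_ *: _); field.
- pose m : subsp_type M := SubspElem (MG h).
  have -> : X h = p1 m by rewrite p1E /= GE.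
  rewrite adjW !WE !linearZ/= p1K !linearZ/= p2K !linearZ/= !scalerA.
  by rewrite -[RHS]scale1r; congr (_ *: _); field.
Qed.

(* Halmos dilation of W. *)
Lemma partial_isometry_unitary (G : hilbertType R) (W : {linear G -> G}) :
  bounded_op W -> (forall x, W (adj W (W x)) = W x) ->
  exists U : {linear hsum G G -> hsum G G}, unitary U /\
    forall x y, U (x, y) = (W x + (y - W (adj W y)), x - adj W (W x) - adj W y).
Proof.
move=> Wb WWW.
have WWWa x : adj W (W (adj W x)) = adj W x.
  by apply: ip_ext => z; rewrite -adjP// -adjPr// -adjP// WWW adjP.
have lcD a (u v u' v' : G) :
    (a *: u + u') + (a *: v + v') = a *: (u + v) + (u' + v').
  by rewrite addrACA -scalerDr.
have lcB a (u v u' v' : G) :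
    (a *: u + u') - (a *: v + v') = a *: (u - v) + (u' - v').
  by rewrite opprD addrACA -scalerBr.
have [U UE] : exists U : {linear hsum G G -> hsum G G}, U =1 (fun u =>
    (W u.1 + (u.2 - W (adj W u.2)), u.1 - adj W (W u.1) - adj W u.2)).
  apply: linear_pack => a [x y] [x' y'] /=.
  rewrite linearP (linearP (adj W)) (linearP W) (linearP (adj W)).
  by rewrite !lcB lcD.
exists U; split=> [|x y]; last by rewrite UE.
split=> [[x y]|[a b]].
  (* Since W W^* and W^* W are projections, the two summands of each component of U (x, y) are
     orthogonal: W x and [q] in the first, [r] and W^* y in the second. *)
  pose q := y - W (adj W y); pose r := x - adj W (W x).
  have pq : ip (W x) q = 0.
    by rewrite ipBr -[ip _ (W (adj W y))]adjPr// -adjP// WWW subrr.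
  have rs : ip r (adj W y) = 0 by rewrite ipBl -!adjP// WWW subrr.
  have qq : ip q q = ip y y - ip (adj W y) (adj W y).
    rewrite [LHS]ipBr -[ip q (W (adj W y))]ip_conj.
    rewrite [ip (W _) q]ipBr -[ip _ (W (adj W y))]adjPr// -adjP// WWW subrr.
    by rewrite conjC0 subr0 ipBl adjP.
  have rr : ip r r = ip x x - ip (W x) (W x).
    rewrite [LHS]ipBr -adjP// [W r]linearB/= WWW subrr ip0l subr0.
    by rewrite ipBl adjPr.
  apply: norm_ipP; rewrite UE /= !ip_hsum/= -/q -/r.
  by rewrite (ip_pythagD pq) (ip_pythagB rs) qq rr; ring.
(* The preimage is the adjoint block matrix applied to (a, b). *)
exists (adj W a + (b - adj W (W b)), a - W (adj W a) - W b); rewrite UE/=.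
have -> : W (adj W a + (b - adj W (W b))) = W (adj W a).
  by rewrite linearD linearB/= WWW subrr addr0.
have -> : adj W (a - W (adj W a) - W b) = - adj W (W b).
  by rewrite !linearB/= WWWa subrr sub0r.
rewrite WWWa linearN/= WWW !opprK subrK addrC subrK.
by rewrite [adj W a + _]addrC addrK subrK.
Qed.

Lemma unitary_extension H (G : hilbertType R) (X Y : {linear H -> G}) :
  (forall h, `|X h| = `|Y h|) ->
  exists U : {linear hsum G G -> hsum G G},
    unitary U /\ forall h, U (X h, 0) = (Y h, 0).
Proof.
move=> XY; have [W [Wb WX WWW WWX]] := partial_isometry XY.
have [U [Uu UE]] := partial_isometry_unitary Wb WWW.
by exists U; split => // h; rewrite UE !linear0 WWX WX subrr !addr0.
Qed.

(** W^* W is self-adjoint and fixes the range of [X], so W^* W x - x is orthogonal to that dense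
    range and vanishes. *)
Lemma isometry_extension H K1 K2 (X : {linear H -> K1}) (Y : {linear H -> K2}) :
  (forall h, `|X h| = `|Y h|) -> dense (range X) ->
  exists2 W : {linear K1 -> K2}, isometric W & forall h, W (X h) = Y h.
Proof.
move=> XY /dense_normP Xd; have [W [Wb WX _ WWX]] := partial_isometry XY.
exists W => //; apply: isometricP => // x; apply/eqP; rewrite -subr_eq0.
apply/eqP; set z := adj W (W x) - x.
have zX h : ip z (X h) = 0 by rewrite ipBl adjPr// adjP// WWX subrr.
apply: norm_small_eq0 => e e0.
have [->|z0] := eqVneq z 0; first by rewrite normr0 ltW.
have [_ [h _ <-] /ltW zh] := Xd z _ e0.
have zp : 0 < `|z| by rewrite normr_gt0.
rewrite -(ler_pM2l zp) -expr2 -ip_norm -[leLHS]subr0 -(zX h) -ipBr.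
rewrite -(ger0_norm (_ : 0 <= ip _ _)).
  by rewrite (le_trans (ip_le _ _))// ler_wpM2l.
by rewrite ipBr zX subr0 ip_norm exprn_ge0.
Qed.

End partial_isometry.

(** * Special tuples: Type I identities, invariance and existence *)

Section special_tuples.
Variables (R : realType) (H : separableHilbertType R) (T1 T2 : {linear H -> H}).
Hypothesis T12 : commuting_contractive_pair T1 T2.
Local Notation T := (T1 \o T2 : {linear H -> H}).
Local Notation D1 := (subsp_type (defect_space T1)).
Local Notation D2 := (subsp_type (defect_space T2)).
Local Notation DT := (subsp_type (defect_space T)).

Let T1c : contractive T1. Proof. by case: T12. Qed.
Let T2c : contractive T2. Proof. by case: T12. Qed.
Let T1b : bounded_op T1. Proof. exact: contractive_bounded T1c. Qed.
Let T2b : bounded_op T2. Proof. exact: contractive_bounded T2c. Qed.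

Let Tc : contractive T.
Proof. by move=> x /=; rewrite (le_trans (T1c _)). Qed.

Let adjT h : adj T h = adj T2 (adj T1 h).
Proof.
move: h; apply: adj_eq => [|x y /=]; first exact: contractive_bounded Tc.
by rewrite !adjP.
Qed.

Let adjT12 h : adj T2 (adj T1 h) = adj T1 (adj T2 h).
Proof.
by case: T12 => _ _ TT; apply: ip_ext => z; rewrite -!adjP// TT.
Qed.

Lemma to_defect_linear (A : {linear H -> H}) : linear (to_defect A).
Proof. by move=> a x y; apply: val_inj; rewrite /= linearP. Qed.

Lemma to_defect_dense (A : {linear H -> H}) : dense (range (to_defect A)).
Proof.
apply/dense_normP => x e e0; have := valP x.
rewrite inE => /closure_normP/(_ e e0)[_ [h _ <-] xh].
by exists (to_defect A h); [exists h|rewrite subsp_norm].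
Qed.

Lemma sqr_to_defect (A : {linear H -> H}) h : contractive A ->
  `|to_defect A h| ^+ 2 = `|h| ^+ 2 - `|adj A h| ^+ 2.
Proof.
by move=> Ac; rewrite subsp_norm -!ip_norm; exact: defect_adj_ip.
Qed.

Section canonical_projection.
Variables (F : hilbertType R) (P0 : {linear F -> F}).
Implicit Types (a : D1) (b : D2).

Lemma canonical_proj0 a b : canonical_proj P0 (a, b, 0) = (a, 0, 0).
Proof. by rewrite /canonical_proj/= linear0. Qed.

Lemma perp_canonical_proj0 a b : perp (canonical_proj P0) (a, b, 0) = (0, b, 0).
Proof.
rewrite /perp [X in _ - X]canonical_proj0.
transitivity ((a - a, b - 0, 0 - 0) : hsum (hsum D1 D2) F) => //.
by rewrite subrr !subr0.
Qed.

Lemma add_canonical_proj0 a b :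
  ((a, 0, 0) : hsum (hsum D1 D2) F) + (0, b, 0) = (a, b, 0).
Proof.
transitivity ((a + 0, 0 + b, 0 + 0) : hsum (hsum D1 D2) F) => //.
by rewrite add0r !addr0.
Qed.

End canonical_projection.

Lemma canonical_special_type_I (c : canonical_special_data T1 T2) :
  type_I_ando_tuple (canonical_special_tuple c).
Proof.
split=> h /=; rewrite !csa_LambdaE.
  rewrite !csa_UE perp_canonical_proj0 canonical_proj0 addrC.
  by rewrite add_canonical_proj0 adjT adjT12.
(* With k = T2^* h, the two parts add up to D_{T1^*} k + D_{T2^*} T1^* k, which is U Lambda D_{T^*}
   k; applying [adj U] leaves the right-hand side. *)
rewrite -linearD perp_canonical_proj0 canonical_proj0 add_canonical_proj0.
rewrite adjT adjT12 -csa_UE isometric_adjK//.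
by have [] := csa_UP c.
Qed.

Lemma coincide_type_I (A A' : pre_ando_tuple T1 T2) :
  coincide A A' -> type_I_ando_tuple A' -> type_I_ando_tuple A.
Proof.
move=> [tau [tauU tauL tauP tauU']] [I1 I2].
have tauK := isometric_adjK tauU.1.
have tP x : tau (ando_P A x) = ando_P A' (tau x) by rewrite -tauP tauK.
have tp x : tau (perp (ando_P A) x) = perp (ando_P A') (tau x).
  by rewrite /perp linearB/= tP.
have tU x : tau (ando_U A x) = ando_U A' (tau x) by rewrite -tauU' tauK.
have UA := ando_UP A; have UA' := ando_UP A'.
(* Writing x = U U^* x moves the intertwining from U to its adjoint. *)
have tUa x : tau (adj (ando_U A) x) = adj (ando_U A') (tau x).
  by rewrite -[in RHS](unitary_adjKV UA x) tU isometric_adjK//; case: UA'.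
have tau_inj : injective tau by exact: can_inj tauK.
split=> h; apply: tau_inj; rewrite linearD/=.
  by rewrite tp tP !tU !tauL I1.
by rewrite !tUa tP tp !tauL I2.
Qed.

Lemma canonical_special_data_inhabited :
  inhabited (canonical_special_data T1 T2).
Proof.
have [X XE] := linear_pack (to_defect_linear T).
have [Y YE] : exists Y : {linear H -> hsum D1 D2},
    Y =1 (fun h => (to_defect T1 (adj T2 h), to_defect T2 h)).
  by apply: linear_pack => a x y; rewrite linearP !to_defect_linear.
have [Z ZE] : exists Z : {linear H -> hsum D1 D2},
    Z =1 (fun h => (to_defect T1 h, to_defect T2 (adj T1 h))).
  by apply: linear_pack => a x y; rewrite linearP !to_defect_linear.
have [Y' Y'E] : exists Y' : {linear H -> hsum (hsum D1 D2) (hsum D1 D2)},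
    Y' =1 (fun h => (Y h, 0)).
  apply: linear_pack => a x y; rewrite linearP.
  transitivity ((a *: Y x + Y y, a *: 0 + 0)
    : hsum (hsum D1 D2) (hsum D1 D2)) => //.
  by rewrite scaler0 addr0.
(* The sum telescopes: |T2^* h|^2 - |T1^* T2^* h|^2 plus |h|^2 - |T2^* h|^2. For [Z] the
   intermediate term is |T1^* h|^2. *)
have sqrY h : `|Y h| ^+ 2 = `|h| ^+ 2 - `|adj T h| ^+ 2.
  by rewrite sqr_hsum_norm YE /= !sqr_to_defect// adjT adjT12 addrC subrKA.
have YZ h : `|Y h| = `|Z h|.
  apply: norm_ipP; rewrite !ip_norm sqrY sqr_hsum_norm ZE /= !sqr_to_defect//.
  by rewrite adjT subrKA.
have XY h : `|X h| = `|Y' h|.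
  apply: norm_ipP; rewrite !ip_norm sqr_hsum_norm Y'E /= normr0 expr0n addr0.
  by rewrite sqrY XE sqr_to_defect.
have [|L LP LE] := isometry_extension XY.
  rewrite (_ : X = to_defect T :> (H -> DT)); last exact/funext.
  exact: to_defect_dense.
have [U [UP UE]] := unitary_extension YZ.
(* F0 is the second copy of D1 + D2 from the dilation; any projection on it is admissible, and zero
   is the simplest. *)
pose P0 : {linear hsum D1 D2 -> hsum D1 D2} := \0.
have P0P : orthoproj P0 by split => // x y; rewrite linear0l linear0r.
have UE' h : U ((to_defect T1 (adj T2 h), to_defect T2 h), 0) =
    ((to_defect T1 h, to_defect T2 (adj T1 h)), 0).
  by have := UE h; rewrite YE ZE.
apply: inhabits.
apply: (@CanonicalSpecialData R H T1 T2 (hsum D1 D2) L P0 U LP _ P0P UP UE').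
move=> h.
by rewrite -XE LE Y'E YE.
Qed.

End special_tuples.

(** * Square-summable sequences as an inner product space *)

Section square_summable.
Variables (R : realType) (F : hilbertType R).
Local Notation C := R[i].

Definition psum (u : nat -> F) n : C := \sum_(k < n) `|u k| ^+ 2.

Definition sqsum : set (nat -> F) :=
  [set u | exists M, forall n, psum u n <= M].

Lemma psumS u n : psum u n.+1 = psum u n + `|u n| ^+ 2.
Proof. by rewrite /psum big_ord_recr. Qed.

Lemma psum_ge0 u n : 0 <= psum u n.
Proof. by apply: sumr_ge0 => k _; rewrite exprn_ge0. Qed.

Lemma psum_homo u : {homo psum u : m n / (m <= n)%N >-> m <= n}.
Proof.
apply: homo_leq => // [y x z|n]; first exact: le_trans.
by rewrite psumS lerDl exprn_ge0.
Qed.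

Lemma sqsum_submod : submod_closed (mem sqsum).
Proof.
split=> [|a u v]; rewrite !inE.
  by exists 0 => n; rewrite /psum big1// => k _; rewrite normr0 expr0n.
(* The factor 2 comes from |x + y|^2 <= 2 (|x|^2 + |y|^2), whose defect is |x - y|^2 by the
   parallelogram law. *)
move=> [M Mu] [M' Mv]; exists (2 * (`|a| ^+ 2 * M + M')) => n.
rewrite (@le_trans _ _ (2 * (`|a| ^+ 2 * psum u n + psum v n)))//; last first.
  by rewrite ler_pM2l// lerD// ler_wpM2l// exprn_ge0.
rewrite /psum mulr_sumr -big_split mulr_sumr; apply: ler_sum => k _ /=.
set x := a *: u k; set y := v k.
rewrite -exprMn -normrZ -/x -[leRHS]addr0 -subr_ge0.
have -> : 2 * (`|x| ^+ 2 + `|y| ^+ 2) + 0 - `|x + y| ^+ 2 = `|x - y| ^+ 2.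
  rewrite -!ip_norm (ipDl x y) !(ipDr x y) (ipBl x y) !(ipBr x y); ring.
by rewrite exprn_ge0.
Qed.

Record ell2 := Ell2 { ell2_val : nat -> F; ell2_valP : ell2_val \in sqsum }.

HB.instance Definition _ := [isSub of ell2 for @ell2_val].
HB.instance Definition _ := [Choice of ell2 by <:].
HB.instance Definition _ :=
  GRing.SubChoice_isSubLmodule.Build C (nat -> F) (mem sqsum) ell2 sqsum_submod.

Implicit Types u v w : ell2.

Lemma psum_bounded u : exists M, forall n, psum (val u) n <= M.
Proof. by have := valP u; rewrite inE. Qed.

Definition ell2_inner (u v : ell2) : C :=
  xget 0 [set l | tends (fun n => \sum_(k < n) ip (val u k) (val v k)) l].

(** The limit chosen in [ell2_inner] exists: increments of the partial sums are dominated by those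
    of [s], which is monotone and bounded. *)
Lemma ell2_innerP u v :
  tends (fun n => \sum_(k < n) ip (val u k) (val v k)) (ell2_inner u v).
Proof.
set p := fun n => _; suff [l pl] : exists l, tends p l by exact: (xgetI 0 pl).
apply: complex_complete => e e0.
have [M uM] := psum_bounded u; have [M' vM] := psum_bounded v.
pose s n := psum (val u) n + psum (val v) n.
have sS n : `|ip (val u n) (val v n)| <= s n.+1 - s n.
  have -> : s n.+1 - s n = `|val u n| ^+ 2 + `|val v n| ^+ 2.
    by rewrite /s !psumS; ring.
  rewrite (le_trans (ip_le _ _))//.
  set x := `|val u n|; set y := `|val v n|.
  have xy : x * y *+ 2 <= x ^+ 2 + y ^+ 2.
    by rewrite -subr_ge0 addrAC -sqrrB real_exprn_even_ge0// realB ?normr_real.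
  by rewrite (le_trans _ xy)// mulr2n lerDl mulr_ge0 ?normr_ge0.
have s_cauchy : cauchys s.
  apply: (@mono_cauchys _ _ (M + M')) => n.
    by rewrite addr_ge0 ?psum_ge0// lerD.
  by rewrite lerD// psum_homo.
have pm m n : (n <= m)%N -> `|p m - p n| <= s m - s n.
  elim: m => [|m IH]; first by rewrite leqn0 => /eqP ->; rewrite !subrr normr0.
  rewrite leq_eqVlt => /orP[/eqP ->|]; first by rewrite !subrr normr0.
  rewrite ltnS => /IH nm.
  rewrite (le_trans (ler_distD (p m) _ _))// -[leRHS](subrKA (s m)) lerD//.
  have -> : p m.+1 - p m = ip (val u m) (val v m).
    by rewrite /p big_ord_recr/= [X in X - _]addrC addrK.
  exact: sS.
have [N sN] := s_cauchy _ e0; exists N => m n Nm Nn.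
wlog nm : m n Nm Nn / (n <= m)%N.
  by move=> h; case: (leqP n m) => [|/ltnW] /h; rewrite 1?distrC; exact.
rewrite (le_lt_trans (pm _ _ nm))// (le_lt_trans _ (sN _ _ Nm Nn))//.
by rewrite ger0_norm// subr_ge0 lerD// psum_homo.
Qed.

Lemma ell2_inner_eq u v l :
  tends (fun n => \sum_(k < n) ip (val u k) (val v k)) l -> ell2_inner u v = l.
Proof. exact: tends_unique (ell2_innerP _ _). Qed.

Lemma ell2_innerC u v : ell2_inner u v = (ell2_inner v u)^*.
Proof.
apply: ell2_inner_eq.
apply: tends_eq (tends_lipschitz (g := @Num.conj C) ler01 _ (ell2_innerP v u)).
  by move=> n /=; rewrite rmorph_sum; apply: eq_bigr => k _; exact: ip_conj.
by move=> x y; rewrite -rmorphB norm_conjC mul1r.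
Qed.

Lemma ell2_innerPl a u v w :
  ell2_inner (a *: u + v) w = a * ell2_inner u w + ell2_inner v w.
Proof.
apply: ell2_inner_eq.
have := tendsD (tends_lipschitz (g := fun x : C => a * x) (normr_ge0 a) _
  (ell2_innerP u w)) (ell2_innerP v w).
move=> /(_ _)/tends_eq; apply => [n /=|x y]; last by rewrite -mulrBr normrM.
rewrite mulr_sumr -big_split; apply: eq_bigr => k _ /=.
by rewrite -ipPl.
Qed.

Let inner_Bl w : zmod_morphism (ell2_inner ^~ w).
Proof.
by move=> x y; rewrite addrC -scaleN1r ell2_innerPl mulN1r addrC.
Qed.
Let inner_Br u : zmod_morphism (ell2_inner u).
Proof. by move=> x y; rewrite !(ell2_innerC u) inner_Bl rmorphB. Qed.
Let inner_Zl w : scalable_for *%R (ell2_inner ^~ w).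
Proof.
move=> a x; rewrite -[a *: x]addr0 ell2_innerPl.
by rewrite -(subrr x) inner_Bl subrr addr0.
Qed.
Let inner_Zr u : scalable_for (@Num.conj C \; *%R) (ell2_inner u).
Proof. by move=> a x; rewrite !(ell2_innerC u) inner_Zl rmorphM. Qed.
HB.instance Definition _ := isBilinear.Build C ell2 ell2 C *%R
  (@Num.conj C \; *%R) ell2_inner inner_Bl inner_Br inner_Zl inner_Zr.

Let inner_herm u v : ell2_inner u v = (-1) ^+ false * (ell2_inner v u)^*.
Proof. by rewrite expr0 mul1r -ell2_innerC. Qed.
HB.instance Definition _ := isHermitianSesquilinear.Build C ell2 false
  (@Num.conj C) ell2_inner inner_herm.

Lemma psum_tends u : tends (psum (val u)) (ell2_inner u u).
Proof.
apply: tends_eq (ell2_innerP u u) => n.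
by apply: eq_bigr => k _; rewrite ip_norm.
Qed.

Lemma psum_le_inner u n : psum (val u) n <= ell2_inner u u.
Proof.
rewrite -subr_ge0.
apply: (@tends_ge0 _ (fun m => psum (val u) (m + n) - psum (val u) n)).
  by move=> m; rewrite subr_ge0 psum_homo// leq_addl.
move=> e e0; have [N uN] := psum_tends u e0; exists N => m Nm.
rewrite opprB addrA subrK uN//.
by rewrite (leq_trans Nm)// leq_addr.
Qed.

Lemma inner_le_psum u M :
  (forall n, psum (val u) n <= M) -> ell2_inner u u <= M.
Proof. by move=> /tends_le; apply; exact: psum_tends. Qed.

Let inner_gt0 u : u != 0 -> 0 < ell2_inner u u.
Proof.
move=> u0; rewrite lt_def (le_trans (psum_ge0 _ 0) (psum_le_inner u 0)) andbT.
apply: contra u0 => /eqP u0; apply/eqP/val_inj/funext => k.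
apply/eqP; rewrite -normr_eq0 -sqrf_eq0 eq_le exprn_ge0// andbT.
by rewrite -u0 (le_trans _ (psum_le_inner u k.+1))// psumS lerDr psum_ge0.
Qed.
HB.instance Definition _ := isDotProduct.Build C ell2 ell2_inner inner_gt0.

HB.instance Definition _ := Lmodule_isPreHilbert.Build R ell2 ell2_inner.

End square_summable.

(** * Completeness of the sequence space *)

Section square_summable_complete.
Variables (R : realType) (F : hilbertType R).
Local Notation C := R[i].
Local Notation T := (ell2 F).
Implicit Types u v : T.

Lemma ell2_linE a u v k : val (a *: u + v) k = a *: val u k + val v k.
Proof. by []. Qed.

Lemma psum_le_norm u n : psum (val u) n <= `|u| ^+ 2.
Proof. by rewrite sqr_norm_inner; exact: psum_le_inner. Qed.

Lemma sqr_norm_le_psum u M : (forall n, psum (val u) n <= M) -> `|u| ^+ 2 <= M.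
Proof. by rewrite sqr_norm_inner; exact: inner_le_psum. Qed.

Lemma norm_le_psum u (M : C) : 0 <= M ->
  (forall n, psum (val u) n <= M ^+ 2) -> `|u| <= M.
Proof.
by move=> M0 uM; rewrite -(ler_pXn2r (_ : 0 < 2)%N) ?nnegrE// sqr_norm_le_psum.
Qed.

Lemma ell2_coord_le u k : `|val u k| <= `|u|.
Proof.
rewrite -(ler_pXn2r (_ : 0 < 2)%N) ?nnegrE//.
rewrite (le_trans _ (psum_le_norm u k.+1))//.
by rewrite psumS lerDr psum_ge0.
Qed.

Lemma tends_sqr (a : nat -> C) (l : C) :
  tends a l -> tends (fun n => a n ^+ 2) (l ^+ 2).
Proof.
move=> al e e0.
(* The summand e makes e / d <= 1, hence |a n - l| <= 1; then [d] bounds |a n + l| = |(a n - l) + 2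
   l|. *)
pose d : C := 1 + `|l| *+ 2 + e.
have d0 : 0 < d by rewrite ltr_wpDl// addr_ge0 ?mulrn_wge0.
have [N aN] := al _ (divr_gt0 e0 d0); exists N => n /aN h.
rewrite subr_sqr normrM.
have h1 : `|a n - l| <= 1.
  rewrite (le_trans (ltW h))// ler_pdivrMr// mul1r /d lerDr addr_ge0//.
  by rewrite mulrn_wge0.
have h2 : `|a n + l| <= d.
  have -> : a n + l = (a n - l) + l *+ 2 by rewrite mulr2n addrA subrK.
  rewrite (le_trans (ler_normD _ _))// normrMn /d -[leLHS]addr0.
  by rewrite lerD ?lerD// ltW.
rewrite (@le_lt_trans _ _ (`|a n - l| * d))//; last by rewrite -ltr_pdivlMr.
by rewrite ler_wpM2l.
Qed.

Lemma psum_tends_coord (y : nat -> nat -> F) (x : nat -> F) n :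
  (forall k, (k < n)%N -> tends (y ^~ k) (x k)) ->
  tends (fun j => psum (y j) n) (psum x n).
Proof.
elim: n => [|n IH] yx.
  rewrite /psum big_ord0; move=> e e0; exists 0%N => j _.
  by rewrite big_ord0 subrr normr0.
have xn : tends (fun j => `|y j n|) `|x n|.
  apply: (@tends_lipschitz _ _ _ (fun z : F => `|z|) 1 _ _ ler01 _
    (yx n (leqnn _))) => a b.
  by rewrite mul1r ler_dist_dist.
rewrite psumS; apply: tends_eq (tendsD (IH _) (tends_sqr xn)) => [j|k kn].
  by rewrite -psumS.
by apply: yx; rewrite ltnS ltnW.
Qed.

Let ell2_complete (Fi : set_system T) : ProperFilter Fi -> cauchy Fi -> cvg Fi.
Proof.
move=> FF /cauchyP Fc.
have /choice[l lP] : forall k, exists l : F, (fun u : T => val u k) @ Fi --> l.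
  move=> k; suff : cauchy ((fun u : T => val u k) @ Fi).
    by move=> /cauchy_cvg/cvg_ex.
  apply/cauchy_exP => e e0; have [x Fx] := Fc e e0; exists (val x k).
  apply: (@filterS _ Fi _ (ball x e)) => // y.
  rewrite -ball_normE /ball_ /mkset => h.
  change (ball (val x k) e (val y k)); rewrite -ball_normE /ball_ /mkset.
  exact: le_lt_trans (ell2_coord_le (x - y) k) h.
have near x (e : C) : 0 < e -> Fi (ball x e) ->
    forall n, psum (fun k => val x k - l k) n <= e ^+ 2.
  move=> e0 Fx n.
  (* For fixed n only finitely many coordinates must be close to [l], and a filter is closed under
     finite intersections, so the ball contains such a [y]. Letting j grow bounds the n-th partial
     sum of x - l. *)
  have /choice[y yP] : forall j, exists y : T, ball x e y /\
      forall k, (k < n)%N -> `|val y k - l k| < j.+1%:R^-1.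
    move=> j; apply: (@filter_ex _ Fi); apply: filterI => //.
    have j0 : 0 < j.+1%:R^-1 :> C by rewrite invr_gt0 ltr0Sn.
    elim: n => [|n IH]; first by apply: filterS filterT => y _.
    have Fn : Fi [set y : T | ball (l n) j.+1%:R^-1 (val y n)].
      exact: (cvg_ball (lP n) j0).
    apply: filterS (filterI IH Fn) => y [yn].
    rewrite /mkset -ball_normE /ball_/= => yn' k.
    by rewrite ltnS leq_eqVlt => /orP[/eqP ->|/yn//]; rewrite distrC.
  apply: tends_le (psum_tends_coord (y := fun j k => val x k - val (y j) k) _).
    move=> j; have [xy _] := yP j; move: xy; rewrite -ball_normE /ball_/= => xy.
    rewrite (le_trans (psum_le_norm (x - y j) n))//.
    by rewrite lerXn2r ?nnegrE// ?ltW.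
  move=> k kn e' e'0; have [N Ne] := invS_lt_complex e'0.
  exists N => j Nj; rewrite opprB addrC addrA subrK distrC.
  rewrite (lt_le_trans ((yP j).2 k kn))// (le_trans _ (ltW Ne))//.
  by rewrite lef_pV2 ?posrE ?ltr0Sn// ler_nat ltnS.
have lS : l \in @sqsum R F.
  have [x Fx] := Fc 1 ltr01.
  have xl : (fun k => val x k - l k) \in @sqsum R F.
    by rewrite inE; exists (1 ^+ 2); exact: near.
  have -> : l = -1 *: (fun k => val x k - l k) + val x.
    by apply/funext => k; rewrite /= !fctE scaleN1r opprB subrK.
  by have [_ +] := @sqsum_submod R F; apply => //; exact: valP x.
apply/cvg_ex; exists (Ell2 lS); apply/fcvg_ballP => e e0.
have e20 : 0 < e / 2 by rewrite divr_gt0.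
have [x Fx] := Fc _ e20.
apply: (@filterS _ Fi _ (ball x (e / 2))) => // y.
rewrite -!ball_normE /ball_ /mkset => xy.
rewrite (le_lt_trans (ler_distD x _ _))// (splitr e) ler_ltD// distrC.
by apply: norm_le_psum; [exact: ltW|exact: near].
Qed.
HB.instance Definition _ := Uniform_isComplete.Build T ell2_complete.

End square_summable_complete.

(** * Separability of the sequence space *)

Section square_summable_separable.
Variables (R : realType) (F : separableHilbertType R).
Local Notation C := R[i].
Local Notation T := (ell2 F).

Lemma sqsum_finite (u : nat -> F) N : (forall k, (N <= k)%N -> u k = 0) ->
  u \in @sqsum R F.
Proof.
move=> uN; rewrite inE; exists (psum u N) => n.
have [/psum_homo//|] := leqP n N; move=> /ltnW.
elim: n => [|n IH]; first by rewrite leqn0 => /eqP ->.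
rewrite leq_eqVlt => /orP[/eqP ->//|]; rewrite ltnS => Nn.
by rewrite psumS uN// normr0 expr0n addr0 IH.
Qed.

Let ell2_sep : exists2 S : set T, countable S & dense S.
Proof.
have [S /countable_injP[f fI] /dense_normP Sd] := @separable_ex R F.
pose g n : F := xget 0 [set x | S x /\ f x = n].
have gK x : S x -> g (f x) = x.
  move=> Sx; rewrite /g; case: xgetP => [y _ [Sy fy]|/(_ x)]; last by case.
  by apply: fI => //; rewrite inE.
(* The dense set consists of finitely supported sequences with entries coded by natural numbers, so
   [seq nat] enumerates it. *)
pose p0 (s : seq nat) k : F := if (k < size s)%N then g (nth 0%N s k) else 0.
have pS s : p0 s \in @sqsum R F.
  by apply: (@sqsum_finite _ (size s)) => k; rewrite /p0 leqNgt => /negPf ->.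
exists (range (fun s => Ell2 (pS s))).
  apply: sub_countable (card_image_le _ _) _; exact: countableP.
apply/dense_normP => u e e0.
have e20 : 0 < e / 2 by rewrite divr_gt0.
have [N uN] := psum_tends u (exprn_gt0 2 e20).
have {}uN : `|u| ^+ 2 - psum (val u) N < (e / 2) ^+ 2.
  rewrite sqr_norm_inner -[ltLHS]ger0_norm ?subr_ge0; last exact: psum_le_inner.
  by rewrite distrC uN.
(* N squares of this tolerance sum to at most (e / 2)^2, and N + 1 keeps the divisor nonzero.
   Together with the tail the squared distance stays below 2 (e / 2)^2 <= e^2. *)
have d0 : 0 < e / 2 / N.+1%:R by rewrite divr_gt0.
have /choice[x xP] : forall k, exists n, `|val u k - g n| < e / 2 / N.+1%:R.
  by move=> k; have [x Sx ux] := Sd (val u k) _ d0; exists (f x); rewrite gK.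
pose s := mkseq x N; exists (Ell2 (pS s)); first by exists s.
set v : T := u - Ell2 (pS s).
have vlt k : (k < N)%N -> `|val v k| < e / 2 / N.+1%:R.
  by move=> kN; rewrite /v /= !fctE /p0 size_mkseq kN nth_mkseq//; exact: xP.
have vge k : (N <= k)%N -> val v k = val u k.
  by move=> Nk; rewrite /v /= !fctE /p0 size_mkseq ltnNge Nk subr0.
have vN : psum (val v) N <= (e / 2) ^+ 2.
  rewrite (@le_trans _ _ (\sum_(k < N) (e / 2 / N.+1%:R) ^+ 2))//.
    by apply: ler_sum => k _; rewrite lerXn2r ?nnegrE// ltW// vlt.
  rewrite sumr_const card_ord -[leLHS]mulr_natr expr_div_n -mulrA.
  rewrite ler_piMr ?exprn_ge0 ?(ltW e20)//.
  rewrite mulrC ler_pdivrMr ?exprn_gt0// mul1r expr2 (@le_trans _ _ N.+1%:R)//.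
    by rewrite ler_nat.
  by rewrite ler_peMl ?ler1n// ltW.
have vbd n : psum (val v) n <= (e / 2) ^+ 2 + (`|u| ^+ 2 - psum (val u) N).
  have [nN|/ltnW Nn] := leqP n N.
    rewrite (le_trans (psum_homo _ nN))// (le_trans vN)// lerDl subr_ge0.
    exact: psum_le_norm.
  suff h : psum (val v) n <= (e / 2) ^+ 2 + (psum (val u) n - psum (val u) N).
    by rewrite (le_trans h)// lerD2l lerD2r psum_le_norm.
  elim: n Nn => [|n IH].
    by rewrite leqn0 => /eqP N00; move: vN; rewrite N00 subrr addr0.
  rewrite leq_eqVlt => /orP[/eqP <-|]; first by rewrite subrr addr0.
  by rewrite ltnS => Nn; rewrite !psumS vge// [_ + _ - _]addrAC addrA lerD2r IH.
rewrite -(ltr_pXn2r (_ : 0 < 2)%N) ?nnegrE ?(ltW e0)//.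
rewrite (le_lt_trans (sqr_norm_le_psum vbd))//.
rewrite (@lt_le_trans _ _ ((e / 2) ^+ 2 + (e / 2) ^+ 2)) ?ltrD2l//.
have -> : (e / 2) ^+ 2 + (e / 2) ^+ 2 = e ^+ 2 / 2 by field.
by rewrite ler_pdivrMr// ler_peMr ?exprn_ge0 ?(ltW e0)// ler1n.
Qed.
HB.instance Definition _ := isSeparable.Build T ell2_sep.

End square_summable_separable.

(** * Diagonal operators and shifts on the sequence space *)

Section ell2_operators.
Variable R : realType.
Local Notation C := R[i].
Implicit Types F H : hilbertType R.

Lemma ell2_map F (U : {linear F -> F}) : isometric U ->
  exists2 G : {linear ell2 F -> ell2 F}, isometric G &
    forall u k, val (G u) k = U (val u k).
Proof.
move=> Ui.
have Up (u : ell2 F) n : psum (fun k => U (val u k)) n = psum (val u) n.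
  by apply: eq_bigr => k _; rewrite Ui.
have US (u : ell2 F) : (fun k => U (val u k)) \in @sqsum R F.
  by rewrite inE; have [M uM] := psum_bounded u; exists M => n; rewrite Up.
have [G GE] : exists G : {linear ell2 F -> ell2 F}, G =1 (fun u => Ell2 (US u)).
  apply: linear_pack => a u v; apply/val_inj/funext => k /=.
  by rewrite !fctE linearP.
exists G => [u|u k]; last by rewrite GE.
apply/le_anti/andP; split; apply: norm_le_psum => // n.
  by rewrite GE Up psum_le_norm.
by rewrite -Up (le_trans _ (psum_le_norm (G u) n))// GE.
Qed.

(* A block ((a, b), (c, d)) of the sequence is read as two columns a, b and
   c, d.
   S moves both columns down by one place, so that S twice is the shift by one
   block; the second column is the room that unitary_extension needs. *)
Lemma half_shift H (F := hsum (hsum H H) (hsum H H)) :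
  exists2 S : {linear hsum H (ell2 F) -> ell2 F}, isometric S &
    forall e e' u, val (S (e, S (e', u))) 0 = ((e, e'), (0, 0)) /\
      forall k, val (S (e, S (e', u))) k.+1 = val u k.
Proof.
pose mix (w w' : F) : F := ((w.1.2, w'.1.1), (w.2.2, w'.2.1)).
have mix_lin a w w' z z' :
  mix (a *: w + z) (a *: w' + z') = a *: mix w w' + mix z z' by [].
(* Block 0 is preceded by a virtual block whose second entries are [x.1] and 0; [mix] thus inserts
   [x.1] on top of the first column and 0 on top of the second. *)
pose prev (x : hsum H (ell2 F)) k : F :=
  if k is j.+1 then val x.2 j else ((0, x.1), (0, 0)).
have prev_lin a x y k : prev (a *: x + y) k = a *: prev x k + prev y k.
  case: k => [|k]; last exact: ell2_linE.
  transitivity (((a *: 0 + 0, a *: x.1 + y.1), (a *: 0 + 0, a *: 0 + 0))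
    : F) => //.
  by rewrite scaler0 addr0.
pose hs x k := mix (prev x k) (val x.2 k).
have hs_lin a x y k : hs (a *: x + y) k = a *: hs x k + hs y k.
  by rewrite /hs prev_lin -mix_lin -ell2_linE.
have sqF (w : F) : `|w| ^+ 2 =
    `|w.1.1| ^+ 2 + `|w.1.2| ^+ 2 + (`|w.2.1| ^+ 2 + `|w.2.2| ^+ 2).
  by rewrite !sqr_hsum_norm.
(* The first n + 1 new blocks hold [x.1], the first n old blocks and half of the next one, so the
   partial sums interlace and have the same supremum. *)
have hsP x n : psum (hs x) n.+1 = `|x.1| ^+ 2 + psum (val x.2) n +
    (`|(val x.2 n).1.1| ^+ 2 + `|(val x.2 n).2.1| ^+ 2).
  elim: n => [|n IH].
    by rewrite psumS /psum !big_ord0 sqF /= normr0 expr0n /=; ring.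
  by rewrite psumS IH psumS !sqF /=; ring.
have le1 x n : psum (hs x) n <= `|x| ^+ 2.
  rewrite (le_trans (psum_homo _ (leqnSn n)))// hsP sqr_hsum_norm -addrA lerD2l.
  rewrite (le_trans _ (psum_le_norm x.2 n.+1))// psumS lerD2l sqF.
  by rewrite lerD// lerDl exprn_ge0.
have le2 x n : `|x.1| ^+ 2 + psum (val x.2) n <= psum (hs x) n.+1.
  by rewrite hsP lerDl addr_ge0 ?exprn_ge0.
have hsS x : hs x \in @sqsum R F by rewrite inE; exists (`|x| ^+ 2).
have [S SE] : exists S : {linear hsum H (ell2 F) -> ell2 F},
    S =1 (fun x => Ell2 (hsS x)).
  by apply: linear_pack => a x y; apply/val_inj/funext => k; exact: hs_lin.
have SV x k : val (S x) k = mix (prev x k) (val x.2 k) by rewrite SE.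
exists S => [x|e e' u].
  apply: (pexpIrn (_ : 0 < 2)%N); rewrite ?nnegrE//; apply/le_anti/andP; split.
    by apply: sqr_norm_le_psum => n; rewrite SE; exact: le1.
  rewrite sqr_hsum_norm -lerBrDl; apply: sqr_norm_le_psum => n.
  rewrite lerBrDl (le_trans (le2 _ _))// SE.
  exact: (psum_le_norm (Ell2 (hsS x))).
split=> [|k]; rewrite SV [prev _ _]/= [X in mix _ X]SV.
  by [].
rewrite SV; case: k => [|k]; rewrite /mix /=.
  by case: (ell2_val u 0) => [[? ?] [? ?]].
by case: (ell2_val u k.+1) => [[? ?] [? ?]].
Qed.


End ell2_operators.

(** * Construction of the lift *)

Section ando_lift.
Variable R : realType.

(* [ando_lift] without separability. *)
Definition hilbert_lift (H K : hilbertType R) (T1 T2 : {linear H -> H}) :=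
  exists (Pi : {linear H -> K}) (V1 V2 : {linear K -> K}),
  [/\ isometric Pi, isometric V1 /\ isometric V2,
      forall k, V1 (V2 k) = V2 (V1 k),
      forall h, adj V1 (Pi h) = Pi (adj T1 h) &
      forall h, adj V2 (Pi h) = Pi (adj T2 h)].

Lemma hilbert_lift_ex (H : hilbertType R) (T1 T2 : {linear H -> H}) :
  contractive T1 -> contractive T2 -> (forall h, T1 (T2 h) = T2 (T1 h)) ->
  hilbert_lift (hsum H (ell2 (hsum (hsum H H) (hsum H H)))) T1 T2.
Proof.
move=> T1c T2c T12.
pose F := hsum (hsum H H) (hsum H H); pose K := hsum H (ell2 F).
have [S Si SE] := half_shift H.
have defectP (A : {linear H -> H}) : contractive A ->
    exists D : {linear H -> H}, forall h, `|D h| ^+ 2 = `|h| ^+ 2 - `|A h| ^+ 2.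
  (* This is D_A, since A^** = A. *)
  move=> Ac; exists (defect_adj (adj A)) => h.
  rewrite -!ip_norm defect_adj_ip; last exact: contractive_adj.
  by rewrite !adjK//; exact: contractive_bounded.
have [D1 D1P] := defectP _ T1c; have [D2 D2P] := defectP _ T2c.
have [X XE] : exists X : {linear H -> hsum H H},
    X =1 (fun h => (D1 (T2 h), D2 h)).
  by apply: linear_pack => a x y; rewrite !linearP.
have [Y YE] : exists Y : {linear H -> hsum H H},
    Y =1 (fun h => (D2 (T1 h), D1 h)).
  by apply: linear_pack => a x y; rewrite !linearP.
have XY h : `|X h| = `|Y h|.
  apply: norm_ipP; rewrite !ip_norm !sqr_hsum_norm XE YE /= !D1P !D2P T12.
  ring.
have [U [Uu UE]] := unitary_extension XY.
have [G Gi GE] := ell2_map Uu.1.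
have Uai : isometric (adj U).
  by move=> y; rewrite -{2}(unitary_adjKV Uu y) Uu.1.
have [G' Gi' GE'] := ell2_map Uai.
have UK := isometric_adjK Uu.1; have UK' := unitary_adjKV Uu.
have G'K u : G' (G u) = u.
  apply/val_inj/funext => k.
  exact: etrans (GE' (G u) k) (etrans (congr1 _ (GE u k)) (UK _)).
(* One form serves both isometries: V_1 has [J] = E and [J'] = id, V_2 has [J] = id and [J'] =
   E^-1. *)
have WP (A D : {linear H -> H}) (J J' : {linear ell2 F -> ell2 F}) :
    (forall h, `|D h| ^+ 2 = `|h| ^+ 2 - `|A h| ^+ 2) ->
    isometric J -> isometric J' ->
    exists2 V : {linear K -> K}, isometric V &
      forall h u, V (h, u) = (A h, J (S (D h, J' u))).
  move=> DP Ji Ji'.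
  have [V VE] : exists V : {linear K -> K},
      V =1 (fun x => (A x.1, J (S (D x.1, J' x.2)))).
    apply: linear_pack => a x y.
    have JS : J (S (D (a *: x + y).1, J' (a *: x + y).2)) =
        a *: J (S (D x.1, J' x.2)) + J (S (D y.1, J' y.2)).
      rewrite !(linearP D) !(linearP J').
      exact: etrans (congr1 J (linearP S a (D x.1, J' x.2) (D y.1, J' y.2)))
        (linearP J _ _ _).
    by rewrite JS (linearP A).
  exists V => [x|h u]; last by rewrite VE.
  apply: (pexpIrn (_ : 0 < 2)%N); rewrite ?nnegrE//.
  by rewrite VE !sqr_hsum_norm/= Ji Si sqr_hsum_norm/= Ji' DP; ring.
have idi : isometric (idfun : {linear ell2 F -> ell2 F}) by [].
have [V1 V1i V1E] := WP T1 D1 G idfun D1P Gi idi.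
have [V2 V2i V2E] := WP T2 D2 idfun G' D2P idi Gi'.
have [Pi PiE] : exists Pi : {linear H -> K}, Pi =1 (fun h => (h, 0)).
  apply: linear_pack => a x y.
  transitivity ((a *: x + y, a *: 0 + 0) : K) => //.
  by rewrite scaler0 addr0.
(* The first component of V sees only the first component of its argument; taking adjoints of this
   gives the intertwining with [Pi]. *)
have lift (A : {linear H -> H}) (V : {linear K -> K}) : contractive A ->
    isometric V -> (forall k, (V k).1 = A k.1) ->
    forall h, adj V (Pi h) = Pi (adj A h).
  move=> Ac Vi VA h; apply: ip_ext => z.
  rewrite -adjP; last exact/contractive_bounded/isometric_contractive.
  rewrite !PiE !ip_hsum/= VA !ip0r !addr0 adjP//.
  exact: contractive_bounded.
have V12 h u : V1 (V2 (h, u)) = V2 (V1 (h, u)).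
  rewrite (V2E h u) (V1E (T2 h)) (V1E h u) (V2E (T1 h)) T12.
  have -> : G' (G (S (D1 h, idfun u))) = S (D1 h, u) by exact: G'K.
  congr (_, _); apply/val_inj/funext => k; rewrite GE.
  have [S0 SS] := SE (D1 (T2 h)) (D2 h) (G' u).
  have [S0' SS'] := SE (D2 (T1 h)) (D1 h) u.
  (* Block 0 is moved by U from X h to Y h; on every later block U undoes the adjoint of U applied
     by [G']. *)
  case: k => [|k].
    apply: etrans (congr1 U S0) (etrans _ (esym S0')).
    by have := UE h; rewrite XE YE.
  apply: etrans (congr1 U (SS k)) (etrans _ (esym (SS' k))).
  exact: etrans (congr1 U (GE' u k)) (UK' _).
have V1k k : (V1 k).1 = T1 k.1 by case: k => h u; rewrite V1E.
have V2k k : (V2 k).1 = T2 k.1 by case: k => h u; rewrite V2E.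
exists Pi, V1, V2; split.
- by move=> h; apply: norm_ipP; rewrite PiE ip_hsum ip0r addr0.
- by split.
- by case=> h u; exact: V12.
- exact: lift T1c V1i V1k.
- exact: lift T2c V2i V2k.
Qed.

(** Both sides agree by conversion once the separable spaces are coerced to Hilbert spaces. *)
Lemma separable_lift (H K : separableHilbertType R) (T1 T2 : {linear H -> H}) :
  hilbert_lift K T1 T2 ->
  exists (Pi : {linear H -> K}) (V1 V2 : {linear K -> K}),
    ando_lift T1 T2 Pi V1 V2.
Proof. by []. Qed.

Lemma ando_lift_ex (H : separableHilbertType R) (T1 T2 : {linear H -> H}) :
  commuting_contractive_pair T1 T2 ->
  exists (K : separableHilbertType R) (Pi : {linear H -> K})
    (V1 V2 : {linear K -> K}), ando_lift T1 T2 Pi V1 V2.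
Proof.
move=> [T1c T2c T12].
exists (hsum H (ell2 (hsum (hsum H H) (hsum H H))) : separableHilbertType R).
apply: separable_lift.
exact: hilbert_lift_ex.
Qed.

End ando_lift.

Theorem theorem4p3p8 (R : realType) (H : separableHilbertType R)
    (T1 T2 : {linear H -> H}) :
  commuting_contractive_pair T1 T2 ->
  [/\ (forall A : pre_ando_tuple T1 T2,
         special_ando_tuple A -> type_I_ando_tuple A),
      (exists A : pre_ando_tuple T1 T2, type_I_ando_tuple A) &
      (exists (K : separableHilbertType R) (Pi : {linear H -> K})
         (V1 V2 : {linear K -> K}), ando_lift T1 T2 Pi V1 V2)].
Proof.
move=> T12; split.
- move=> A [c Ac]; apply: coincide_type_I Ac _.
  exact: canonical_special_type_I.
- have [c] := canonical_special_data_inhabited T12.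
  by exists (canonical_special_tuple c); exact: canonical_special_type_I.
- exact: ando_lift_ex.
Qed.
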